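(* Consider the scheduling problem under the MaxWeight (MW) scheduling policy (setting in the context). Fix a face $\mathcal F^{(k)}$ of the capacity region $\mathcal R$ and $\boldsymbol\lambda^{(k)}\in\mathrm{Relint}(\mathcal F^{(k)})$, and let the arrival vector process $\{\mathbf A^{(\epsilon)}[t]\}_t$ have mean vector $\boldsymbol\lambda^{(\epsilon)}=\boldsymbol\lambda^{(k)}-\epsilon\,\mathbf c^{(k)}\in\mathrm{Int}(\mathcal R)$, $\epsilon>0$, and variance vector $((\sigma_l^{(\epsilon)})^2)_{l=1}^L$. Then the limiting steady-state queue-length vector $\overline{\mathbf Q}^{(\epsilon)}$ satisfies $$\mathbb E\big[\langle\mathbf c^{(k)},\overline{\mathbf Q}^{(\epsilon)}\rangle\big]\le\frac{\zeta^{(\epsilon,k)}}{2\epsilon}+\overline B_1^{(\epsilon,k)},\qquad \zeta^{(\epsilon,k)}=\sum_{l=1}^L (c_l^{(k)})^2(\sigma_l^{(\epsilon)})^2,$$ for some $\overline B_1^{(\epsilon,k)}$ that is $o(1/\epsilon)$, i.e. $\lim_{\epsilon\downarrow0}\epsilon\,\overline B_1^{(\epsilon,k)}=0$. Consequently, in the heavy-traffic limit $\epsilon\downarrow0$, with the variance vector $((\sigma_l^{(\epsilon)})^2)_l$ converging to a constant vector $(\sigma_l^2)_l$, $$\limsup_{\epsilon\downarrow0}\ \epsilon\,\mathbb E\big[\langle\mathbf c^{(k)},\overline{\mathbf Q}^{(\epsilon)}\rangle\big]\le\frac{\zeta^{(k)}}{2},\qquad \zeta^{(k)}=\sum_{l=1}^L(c_l^{(k)})^2\sigma_l^2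 .$$ Hence MW is first-moment heavy-traffic optimal: in the same limit, any feasible scheduling policy with steady-state queue-length vector $\widehat{\mathbf Q}^{(\epsilon)}$ satisfies $\liminf_{\epsilon\downarrow0}\epsilon\,\mathbb E[\langle\mathbf c^{(k)},\widehat{\mathbf Q}^{(\epsilon)}\rangle]\ge\zeta^{(k)}/2$.
   Context: Scheduling model. There are $L$ queues in slotted time $t=0,1,2,\dots$ with nonnegative-integer lengths $\mathbf Q[t]=(Q_l[t])_{l=1}^L$ evolving as $Q_l[t+1]=(Q_l[t]+A_l[t]-S_l[t])^+$. The arrival processes $\{A_l[t]\}_t$ of different queues are independent; each is i.i.d. over time, nonnegative-integer valued and bounded by $A_{\max}<\infty$. In each slot a scheduler selects a service vector $\mathbf S[t]$ from a fixed finite set $\mathcal S$ of nonnegative-integer vectors in $\mathbb R^L$ with entries at most $S_{\max}<\infty$, containing $\mathbf 0$; any such rule is a feasible scheduling policy. The constants $A_{\max},S_{\max}$ and the set $\mathcal S$ do not depend on $\epsilon$. MW policy: $\mathbf S[t]$ is chosen uniformly at random from $\arg\max_{\mathbf S\in\mathcal S}\langle\mathbf Q[t],\mathbf S\rangle$. Capacity region: $\mathcal R=\mathrm{ConvexHull}(\mathcal S)$, assumed to be described as $\mathcal R=\{\mathbf r\ge\mathbf 0:\langle\mathbf c^{(k)},\mathbf r\rangle\le b^{(k)},\ k=1,\dots,K\}$ with $K$ finite and minimal and $\|\mathbf c^{(k)}\|=1$, $\mathbf c^{(k)}\ge\mathbf 0$ componentwise, $b^{(k)}>0$. Put $\mathcal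 H^{(k)}=\{\mathbf r:\langle\mathbf c^{(k)},\mathbf r\rangle=b^{(k)}\}$ and $\mathcal F^{(k)}=\mathcal H^{(k)}\cap\mathcal R$ (the $k$-th face). $\mathrm{Relint}$ is relative interior, $\mathrm{Int}$ is interior, $\langle\cdot,\cdot\rangle$ and $\|\cdot\|$ are the Euclidean inner product and norm. Steady state: under MW with $\boldsymbol\lambda^{(\epsilon)}\in\mathrm{Int}(\mathcal R)$, the Markov chain $\{\mathbf Q^{(\epsilon)}[t]\}_t$ converges in distribution to a random vector $\overline{\mathbf Q}^{(\epsilon)}$ (its steady state), all of whose moments are finite; this fact is taken as part of the setting. For a general feasible policy, $\widehat{\mathbf Q}^{(\epsilon)}$ denotes the limit in distribution of its queue-length process. *)

(* Defs.v *)
From HB Require Import structures.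
From mathcomp Require Import all_boot all_order all_algebra.
From mathcomp Require Import all_classical all_reals all_analysis.

Set Implicit Arguments.
Unset Strict Implicit.
Unset Printing Implicit Defensive.

Import Order.TTheory GRing.Theory Num.Theory.
Import numFieldNormedType.Exports.

Local Open Scope classical_set_scope.
Local Open Scope ring_scope.

Section Geometry.
Variables (R : realType) (L : nat).
Implicit Types (x y : 'rV[R]_L) (C : set 'rV[R]_L).

Definition inner x y : R := \sum_(l < L) x 0 l * y 0 l.

(* The library norm on row vectors is the sup norm. *)
Definition enorm x : R := Num.sqrt (inner x x).

Definition convex_hull C : set 'rV[R]_L :=
  [set x | exists n (p : 'I_n -> 'rV[R]_L) (a : 'I_n -> R),
    [/\ forall i, C (p i), forall i, 0 <= a i, \sum_i a i = 1
      & x = \sum_i a i *: p i]].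

Definition affine_hull C : set 'rV[R]_L :=
  [set x | exists n (p : 'I_n -> 'rV[R]_L) (a : 'I_n -> R),
    [/\ forall i, C (p i), \sum_i a i = 1 & x = \sum_i a i *: p i]].

Definition relint C : set 'rV[R]_L :=
  [set x | C x /\ \forall y \near within (affine_hull C) (nbhs x), C y].

Definition face_description C K (c : 'I_K -> 'rV[R]_L) (b : 'I_K -> R) : Prop :=
  [/\ forall k, enorm (c k) = 1,
      forall k l, 0 <= c k 0 l,
      forall k, 0 < b k
    & C = [set r : 'rV[R]_L |
             (forall l, 0 <= r 0 l) /\ forall k, inner (c k) r <= b k]].

Definition minimal_face_description C K (c : 'I_K -> 'rV[R]_L) (b : 'I_K -> R) :
    Prop :=
  face_description C c b /\
  forall K' (c' : 'I_K' -> 'rV[R]_L) (b' : 'I_K' -> R),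
    face_description C c' b' -> (K <= K')%N.

Definition face C (ck : 'rV[R]_L) (bk : R) : set 'rV[R]_L :=
  [set r : 'rV[R]_L | inner ck r = bk] `&` C.

Definition zeta (ck : 'rV[R]_L) (sigma : 'I_L -> R) : R :=
  \sum_(l < L) ck 0 l ^+ 2 * sigma l ^+ 2.

End Geometry.

Notation queues L := {ffun 'I_L -> nat}.

(* Entries lie in {0, ..., Smax}, so a {set services L Smax} is an arbitrary
   finite set of nonnegative-integer vectors with entries at most Smax. *)
Notation services L Smax := {ffun 'I_L -> 'I_Smax.+1}.

(* The queue vector is countably valued, so measurability of its level sets is
   measurability for the discrete sigma-algebra. *)
Record random_queue (R : realType) (L : nat) := RandomQueue {
  rq_disp : measure_display;
  rq_space : measurableType rq_disp;
  rq_prob : probability rq_space R;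
  rq_val : rq_space -> queues L;
  rq_measurable : forall q, measurable (rq_val @^-1` [set q]) }.

Record queue_process (R : realType) (L Smax : nat) := QueueProcess {
  qp_disp : measure_display;
  qp_space : measurableType qp_disp;
  qp_prob : probability qp_space R;
  queue : nat -> qp_space -> queues L;
  arrival : nat -> qp_space -> queues L;
  service : nat -> qp_space -> services L Smax;
  queue_measurable : forall t q, measurable (queue t @^-1` [set q]);
  arrival_measurable : forall t a, measurable (arrival t @^-1` [set a]);
  service_measurable : forall t s, measurable (service t @^-1` [set s]) }.

Arguments queue {R L Smax} _ _ _.
Arguments arrival {R L Smax} _ _ _.
Arguments service {R L Smax} _ _ _.

Section Scheduling.
Variables (R : realType) (L Smax : nat).
Implicit Types (Ss : {set services L Smax}) (nu : 'I_L -> probability nat R).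
Implicit Types (X : queue_process R L Smax) (Q : random_queue R L).

Definition queue_vec (q : queues L) : 'rV[R]_L := \row_l (q l)%:R.

Definition service_vec (s : services L Smax) : 'rV[R]_L :=
  \row_l (s l : nat)%:R.

Definition capacity_region Ss : set 'rV[R]_L :=
  convex_hull [set service_vec s | s in [set` Ss]].

Definition weight (q : queues L) (s : services L Smax) : nat :=
  (\sum_(l < L) q l * s l)%N.

Definition argmax_weight Ss (q : queues L) : {set services L Smax} :=
  [set s in Ss | [forall s' in Ss, (weight q s' <= weight q s)%N]]%SET.

(* The family (A_l[t])_{l,t} is mutually independent and A_l[t] has law nu l;
   product rules over subfamilies are obtained by taking some B t l = setT. *)
Definition iid_arrivals nu X : Prop :=
  forall n (B : nat -> 'I_L -> set nat),
    qp_prob X [set w | forall t l, (t < n)%N -> B t l (arrival X t w l)] =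
    (\prod_(t < n) \prod_(l < L) nu l (B t l))%E.

(* The service vector may depend in any way on queue lengths, arrivals, time
   and extra randomness; ssrnat subtraction is truncated at 0. *)
Definition feasible Ss nu X : Prop :=
  [/\ iid_arrivals nu X,
      forall t w, service X t w \in Ss
    & forall t w l, queue X t.+1 w l =
        (queue X t w l + arrival X t w l - service X t w l)%N].

Definition past X (t : nat) (q a : nat -> queues L)
    (s : nat -> services L Smax) : set (qp_space X) :=
  [set w | (forall u, (u <= t)%N -> queue X u w = q u) /\
           forall u, (u < t)%N -> arrival X u w = a u /\ service X u w = s u].
Arguments past X t q a s _ : clear implicits.

(* Given the past, the service vector is uniform on the argmax; the arrivals of
   the slot are independent of the past and of that choice. *)
Definition maxweight Ss nu X : Prop :=
  feasible Ss nu X /\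
  forall t q a s,
    qp_prob X (past X t q a s `&` service X t @^-1` [set s t]) =
      (qp_prob X (past X t q a s) *
       (if s t \in argmax_weight Ss (q t)
        then #|argmax_weight Ss (q t)|%:R^-1 else 0)%:E)%E /\
    qp_prob X (past X t q a s `&` service X t @^-1` [set s t]
                 `&` arrival X t @^-1` [set a t]) =
      (qp_prob X (past X t q a s `&` service X t @^-1` [set s t]) *
       qp_prob X (arrival X t @^-1` [set a t]))%E.

(* Convergence in distribution on the discrete lattice, where every function is
   continuous. *)
Definition converges_in_distribution X Q : Prop :=
  forall h : queues L -> R, (exists M : R, forall q, `|h q| <= M) ->
    ('E_(qp_prob X)[fun w => h (queue X t w)])%E @[t --> \oo] -->
    ('E_(rq_prob Q)[fun w => h (rq_val w)])%E.

Definition finite_moments Q : Prop :=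
  forall m : 'I_L -> nat,
    ('E_(rq_prob Q)[fun w => (\prod_(l < L) (rq_val w l)%:R ^+ m l)%R] < +oo)%E.

Definition mean_inner (ck : 'rV[R]_L) Q : \bar R :=
  ('E_(rq_prob Q)[fun w => inner ck (queue_vec (rq_val w))])%E.

Definition admissible (C : set 'rV[R]_L) (lam : R -> 'rV[R]_L) : set R :=
  [set eps | 0 < eps /\ interior C (lam eps)].

(* For each eps, nu eps l is the common law of the A_l[t]. *)
Definition arrival_laws (Amax : nat) (nu : R -> 'I_L -> probability nat R)
    (lam : R -> 'rV[R]_L) (sigma : R -> 'I_L -> R) (eps : R) : Prop :=
  forall l,
    [/\ nu eps l [set n | (n <= Amax)%N] = 1%E,
        ('E_(nu eps l)[fun n => n%:R%R] = (lam eps 0 l)%:E :> \bar R)%E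
      & variance (nu eps l) (fun n => n%:R) = (sigma eps l ^+ 2)%:E :> \bar R].

End Scheduling.

(* Main.v *)
(** Write [x = <c,q>], [y = |q|^2 - x^2] for the squared distance of [q] to the
    ray spanned by [c], and [r = sqrt eps].

    Upper bound.  MaxWeight gives [y] the drift [-2 delta sqrt y + O(1)], with
    [delta] the radius of a ball of the face around [lamk]; it does not depend on
    [eps].  In the drift of [x^2] the two error terms, the loss of service off the
    face and the unused service, are bounded by [r y] plus [1/r] times quantities
    that the drift of [x] controls.  Hence [x^2 - (C/r) x + 3 r y^2] has drift at
    most [-2 eps x + zeta + O(r)], uniformly in [q], and averaging against the
    stationary law bounds [2 eps E x] by [zeta + O(sqrt eps)].

    Lower bound.  For any policy, [<c,Q[t]>] dominates the Lindley recursion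
    [z' = max(0, z + <c,A> - b)] started at [0].  The function
    [z^2 + b z - tau z^3] is bounded above on [z >= 0] and has drift at least
    [zeta - b eps - O(tau) - 2 eps min(z, 1/tau)]; since its mean along the
    recursion cannot grow linearly, [2 eps E min(x, 1/tau)] is at least
    [zeta - b eps - O(tau)] in the limit law. *)

Require Import Defs.
From HB Require Import structures.
From mathcomp Require Import all_boot all_order all_algebra.
From mathcomp Require Import all_classical all_reals all_analysis.
From mathcomp Require Import measurable_realfun ring lra.
Import Order.TTheory GRing.Theory Num.Theory.
Import numFieldNormedType.Exports.
Local Open Scope classical_set_scope.
Local Open Scope ring_scope.

Set Implicit Arguments.
Unset Strict Implicit.
Unset Printing Implicit Defensive.

(** * Geometry of the capacity region *)

(** Maximality of the chosen service, and the emptiness of any queue that wastes service, trade [x]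
    for the component of the queue orthogonal to [c]; Young's inequality with weight [r] then splits
    the product. The leftover multiples of [r * y] are repaid by [y ^+ 2]: its drift has order [- y]
    to the power 3/2, while its errors are at most linear in [y]. In the lower bound the policy may
    anticipate arrivals, so the queue need not be independent of the next arrival; a recursion
    driven by the arrivals alone restores independence. There [b * z] compensates the reflection at
    0, and [- tau * z ^+ 3] pays for truncating [z], which is forced because convergence in
    distribution tests bounded functions only. *)

Section Inner.
Context {R : realType} {L : nat}.
Implicit Types x y z : 'rV[R]_L.

Lemma innerC x y : inner x y = inner y x.
Proof. by apply: eq_bigr => l _; rewrite mulrC. Qed.

Lemma innerDr x y z : inner x (y + z) = inner x y + inner x z.
Proof.
by rewrite /inner -big_split; apply: eq_bigr => l _; rewrite mxE mulrDr.
Qed.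

Lemma innerZr a x y : inner x (a *: y) = a * inner x y.
Proof. by rewrite /inner mulr_sumr; apply: eq_bigr => l _; rewrite mxE mulrCA. Qed.

Lemma innerDl x y z : inner (x + y) z = inner x z + inner y z.
Proof. by rewrite innerC innerDr !(innerC z). Qed.

Lemma innerZl a x y : inner (a *: x) y = a * inner x y.
Proof. by rewrite innerC innerZr innerC. Qed.

Lemma innerNr x y : inner x (- y) = - inner x y.
Proof. by rewrite -scaleN1r innerZr mulN1r. Qed.

Lemma innerBr x y z : inner x (y - z) = inner x y - inner x z.
Proof. by rewrite innerDr innerNr. Qed.

Lemma innerBl x y z : inner (x - y) z = inner x z - inner y z.
Proof. by rewrite innerC innerBr !(innerC z). Qed.

Lemma inner_sumr x n (a : 'I_n -> R) (p : 'I_n -> 'rV[R]_L) :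
  inner x (\sum_i a i *: p i) = \sum_i a i * inner x (p i).
Proof.
apply: (big_ind2 (fun u v => inner x u = v)) => [|u v u' v' <- <-|i _].
- by rewrite /inner big1 // => l _; rewrite mxE mulr0.
- exact: innerDr.
- exact: innerZr.
Qed.

Lemma inner_ge0 x : 0 <= inner x x.
Proof. by apply: sumr_ge0 => l _; rewrite -expr2 sqr_ge0. Qed.

Lemma inner_nneg x y : (forall l, 0 <= x 0 l) -> (forall l, 0 <= y 0 l) ->
  0 <= inner x y.
Proof. by move=> x0 y0; apply: sumr_ge0 => l _; rewrite mulr_ge0. Qed.

Lemma inner_coord x l : x 0 l ^+ 2 <= inner x x.
Proof.
rewrite /inner (bigD1 l) //= -expr2 lerDl.
by apply: sumr_ge0 => i _; rewrite -expr2 sqr_ge0.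
Qed.

(** Young's inequality, from expanding the squared norm of [r *: x - y]. *)
Lemma inner_AMGM r x y : 0 < r ->
  2 * inner x y <= r * inner x x + inner y y / r.
Proof.
move=> r0; have := inner_ge0 (r *: x - y).
rewrite innerBl !innerBr !innerZl !innerZr (innerC y x) => h.
have -> : r * inner x x + inner y y / r =
  2 * inner x y +
  (r * (r * inner x x) - r * inner x y - (r * inner x y - inner y y)) / r.
  by field; rewrite gt_eqF.
by rewrite lerDl divr_ge0 // ltW.
Qed.

Lemma inner_CS x y : inner x y ^+ 2 <= inner x x * inner y y.
Proof.
have := inner_ge0 (inner y y *: x - inner x y *: y).
rewrite innerBl !innerBr !innerZl !innerZr (innerC y x) => h.
have := inner_ge0 y; rewrite le_eqVlt => /predU1P[y0|y0].
  suff -> : inner x y = 0 by rewrite -y0; lra.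
  rewrite /inner big1 // => l _; have := inner_coord y l.
  rewrite -y0 => yl.
  have /eqP : y 0 l ^+ 2 = 0 by apply/eqP; rewrite eq_le yl sqr_ge0.
  by rewrite sqrf_eq0 => /eqP ->; rewrite mulr0.
rewrite -subr_ge0 -(pmulr_rge0 _ y0); apply: le_trans h _.
by rewrite le_eqVlt; apply/orP; left; apply/eqP; ring.
Qed.

Lemma enorm1 x : enorm x = 1 -> inner x x = 1.
Proof. by rewrite /enorm => e; rewrite -(sqr_sqrtr (inner_ge0 x)) e expr1n. Qed.

End Inner.

(** The reciprocal of one plus the sum of reciprocals replaces a minimum, so that an empty index
    type is no special case. *)
Lemma finite_pos_lb (R : realType) (I : finType) (f : I -> R) :
  (forall i, 0 < f i) -> exists2 d, 0 < d & forall i, d <= f i.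
Proof.
move=> f0; exists (1 + \sum_i (f i)^-1)^-1 => [|i].
  by rewrite invr_gt0 ltr_pwDl // sumr_ge0 // => i _; rewrite invr_ge0 ltW.
rewrite -[leRHS]invrK lef_pV2 ?posrE ?invr_gt0//; last first.
  by rewrite ltr_pwDl // sumr_ge0 // => j _; rewrite invr_ge0 ltW.
rewrite (bigD1 i) //= addrCA lerDl addr_ge0 // sumr_ge0 // => j _.
by rewrite invr_ge0 ltW.
Qed.

(** If no such point existed, dropping the constraint [k] would leave the region unchanged; [lift k]
    enumerates the other constraints, one fewer than the minimum. *)
Lemma minimal_face_irredundant (R : realType) (L K : nat) (C : set 'rV[R]_L)
    (c : 'I_K -> 'rV[R]_L) (b : 'I_K -> R) (k : 'I_K) :
  minimal_face_description C c b ->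
  exists r : 'rV[R]_L, [/\ forall l, 0 <= r 0 l,
    forall j, j != k -> inner (c j) r <= b j & b k < inner (c k) r].
Proof.
case: K c b k => [c b []//|K c b k] [[c1 c0 b0 ->] least].
apply: contrapT => nex.
suff /least : face_description
    [set r : 'rV[R]_L | (forall l, 0 <= r 0 l) /\ forall k, inner (c k) r <= b k]
    (c \o lift k) (b \o lift k) by rewrite ltnn.
split => //=; apply/seteqP; split => r /= [r0 rb]; split => // j.
have rlift i : i != k -> inner (c i) r <= b i.
  by case: (unliftP k i) => [i' -> _|->]; [exact: rb|rewrite eqxx].
have [->|/rlift//] := eqVneq j k.
by rewrite leNgt; apply/negP => rk; apply: nex; exists r.
Qed.

(** * Room around a point in the relative interior of a facet *)

Section Facet.
Context {R : realType} {L K : nat}.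
Context {C : set 'rV[R]_L} {c : 'I_K -> 'rV[R]_L} {b : 'I_K -> R}.
Variables (k : 'I_K) (lamk : 'rV[R]_L).
Hypotheses (Cmin : minimal_face_description C c b)
  (rel : relint (face C (c k) (b k)) lamk).

Let cc j : inner (c j) (c j) = 1.
Proof. by case: Cmin => -[/(_ j)/enorm1]. Qed.

Let c0 j l : 0 <= c j 0 l.
Proof. by case: Cmin => -[]. Qed.

Let b0 j : 0 < b j.
Proof. by case: Cmin => -[]. Qed.

Lemma capacityP r : C r <->
  (forall l, 0 <= r 0 l) /\ forall j, inner (c j) r <= b j.
Proof. by case: Cmin => -[_ _ _ ->]. Qed.

Lemma facet_lamk : C lamk /\ inner (c k) lamk = b k.
Proof. by case: rel => -[]. Qed.

(* Cut by the hyperplane of [k] the segment from a point where no constraint is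
   tight to a point violating the constraint [k] only. *)
Lemma facet_strict_point : exists z : 'rV[R]_L,
  [/\ forall l, 0 < z 0 l, forall j, j != k -> inner (c j) z < b j
    & inner (c k) z = b k].
Proof.
have [r [r0 rj rk]] := minimal_face_irredundant k Cmin.
have [p [p0 pj]] : exists p : 'rV[R]_L,
    (forall l, 0 < p 0 l) /\ (forall j, inner (c j) p < b j).
  have [d d0 db] := finite_pos_lb b0.
  have s0 j : 0 <= \sum_l c j 0 l by exact: sumr_ge0.
  (* A multiple of the all-ones vector: [d] is below every [b j], and the denominator exceeds every
     row sum of [c]. *)
  exists (d / (1 + \sum_j \sum_l c j 0 l) *: const_mx 1); split => [l|j].
    rewrite !mxE mulr1 divr_gt0 // ltr_pwDl // sumr_ge0 // => j _; exact: s0.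
  rewrite innerZr; apply: lt_le_trans (db j).
  have -> : inner (c j) (const_mx 1) = \sum_l c j 0 l.
    by apply: eq_bigr => l _; rewrite mxE mulr1.
  rewrite mulrAC -mulrA gtr_pMr // ltr_pdivrMr; last first.
    by rewrite ltr_pwDl // sumr_ge0.
  rewrite mul1r (bigD1 j) //= addrCA ltrDl ltr_pwDl // sumr_ge0 //.
have pr : 0 < inner (c k) r - inner (c k) p by move: (pj k) rk; lra.
pose t := (b k - inner (c k) p) / (inner (c k) r - inner (c k) p).
have t0 : 0 < t by rewrite divr_gt0 // subr_gt0.
have t1 : t < 1 by rewrite ltr_pdivrMr // mul1r ltrD2r.
exists ((1 - t) *: p + t *: r); split => [l|j jk|].
- rewrite !mxE ltr_pwDl //; last by rewrite mulr_ge0 // ltW.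
  by rewrite mulr_gt0 // subr_gt0.
- rewrite innerDr !innerZr.
  have := pj j; have := rj j jk => h1 h2.
  have -> : b j = (1 - t) * b j + t * b j by ring.
  by rewrite ltr_leD // ?ltr_pM2l ?subr_gt0// ler_wpM2l // ltW.
- rewrite innerDr !innerZr /t; field; rewrite gt_eqF //.
Qed.

(* The segment from a strict point to [lamk] can be prolonged inside the face, so
   [lamk] is a proper convex combination of that point and a point of the face. *)
Lemma relint_facet_strict :
  (forall l, 0 < lamk 0 l) /\ (forall j, j != k -> inner (c j) lamk < b j).
Proof.
have [z [z0 zj zk]] := facet_strict_point.
have [[/= lk lC] near_lam] := rel.
have zC : C z.
  apply/capacityP; split => [l|j]; first exact: ltW.
  by have [->|/zj/ltW//] := eqVneq j k; rewrite zk.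
have [d d0 dC] : exists2 d, 0 < d & face C (c k) (b k) (lamk + d *: (lamk - z)).
  have cont : (fun d : R => lamk + d *: (lamk - z)) @ 0 --> lamk.
    rewrite -[X in _ --> X]addr0; apply: cvgD; first exact: cvg_cst.
    rewrite -(scale0r (lamk - z)); apply: cvgZr_tmp; exact: cvg_id.
  have /cont : nbhs lamk [set y | affine_hull (face C (c k) (b k)) y ->
                             face C (c k) (b k) y].
    exact: near_lam.
  move=> /nbhs_ballP[e /= e0 be].
  exists (e / 2); first by rewrite divr_gt0.
  apply: (be (e / 2)).
    rewrite /ball /= sub0r normrN gtr0_norm; lra.
  (* The prolonged point is the affine combination of [lamk] and [z] with weights [1 + e / 2] and
     [- (e / 2)], so it lies in the affine hull of the face. *)
  exists 2%N, (fun i => if i == 0 then lamk else z),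
    (fun i => if i == 0 then 1 + e / 2 else - (e / 2)); split.
  - by move=> i; case: ifP.
  - by rewrite !big_ord_recl big_ord0 /=; lra.
  - rewrite !big_ord_recl big_ord0 /= addr0 scalerBr scaleNr scalerDl scale1r.
    by rewrite addrA.
case: dC => _ /capacityP[y0 yj]; split => [l|j jk].
- have := y0 l; have := z0 l; rewrite !mxE => h1 h2.
  have : 0 < (1 + d) * lamk 0 l by have := mulr_gt0 d0 h1; lra.
  by rewrite pmulr_rgt0 //; lra.
- have := yj j; have := zj j jk.
  rewrite innerDr innerZr innerBr => h1 h2.
  have := mulr_gt0 d0 (_ : 0 < b j - inner (c j) z).
  rewrite subr_gt0 => /(_ h1) h3.
  rewrite -(@ltr_pM2l _ (1 + d)); lra.
Qed.

Lemma facet_margin : exists2 d, 0 < d &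
  (forall l, d <= lamk 0 l) /\ (forall j, j != k -> inner (c j) lamk + d <= b j).
Proof.
have [l0 lj] := relint_facet_strict.
have [d1 d10 d1l] := finite_pos_lb l0.
have slack j : 0 < if j == k then 1 else b j - inner (c j) lamk.
  by have [//|/lj] := eqVneq j k; rewrite subr_gt0.
have [d2 d20 d2j] := finite_pos_lb slack.
exists (Num.min d1 d2); first by rewrite lt_min d10.
split=> [l|j jk]; first by rewrite ge_min d1l.
by rewrite -lerBrDl ge_min; have := d2j j; rewrite (negPf jk) => ->; rewrite orbT.
Qed.

(** Moving orthogonally to [c k] keeps the constraint [k] tight, and a unit vector changes any other
    constraint or coordinate by at most 1, which the margin absorbs. *)
Lemma facet_ball : exists2 d, 0 < d & forall e : 'rV[R]_L,
  inner (c k) e = 0 -> inner e e <= 1 -> C (lamk + d *: e).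
Proof.
have [d d0 [dl dj]] := facet_margin; exists d => // e ke e1.
apply/capacityP; split => [l|j].
- rewrite !mxE; have := inner_coord e l => h.
  have el : -1 <= e 0 l by have := sqr_ge0 (1 + e 0 l); nra.
  have : d * (-1) <= d * e 0 l by rewrite ler_pM2l.
  by move: (dl l); lra.
- rewrite innerDr innerZr; have [->|jk] := eqVneq j k.
    by rewrite ke mulr0 addr0 facet_lamk.2.
  have := dj j jk.
  have := inner_AMGM (c j) e (@ltr01 R); rewrite cc mul1r divr1 => h2.
  have : d * inner (c j) e <= d * 1 by rewrite ler_pM2l //; lra.
  by lra.
Qed.

(** The shift opens a slack of exactly [eps] in the constraint [k], since [c k] has norm 1; it only
    relaxes the others, since all [c j] are nonnegative; and it lowers each coordinate by at most
    [eps]. The factor [1 + L%:R] converts the sup-norm ball of the library. *)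
Lemma interior_shift_facet :
  \forall eps \near 0^'+, interior C (lamk - eps *: c k).
Proof.
have [d d0 [dl dj]] := facet_margin.
have cl j l : c j 0 l <= 1.
  by have := inner_coord (c j) l; rewrite cc; have := c0 j l; nra.
near=> e.
have e0 : 0 < e by near: e; exact: nbhs_right_gt.
have ed : e < d by near: e; exact: nbhs_right_lt.
pose m := Num.min (d - e) e.
have m0 : 0 < m by rewrite lt_min e0 subr_gt0 ed.
have m1 : m <= d - e by rewrite ge_min lexx.
have m2 : m <= e by rewrite ge_min lexx orbT.
have L0 : 0 < 1 + L%:R :> R by rewrite ltr_pwDl.
rewrite /interior /= nbhs_ballP; exists (m / (1 + L%:R)) => /=.
  by rewrite divr_gt0.
move=> y; rewrite /ball /= /mx_ball => yb.
have yl l : `|lamk 0 l - e * c k 0 l - y 0 l| <= m / (1 + L%:R).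
  by have := yb.2 0 l; rewrite /ball /= !mxE => /ltW.
have small l : `|lamk 0 l - e * c k 0 l - y 0 l| <= m.
  by apply: le_trans (yl l) _; rewrite ler_pdivrMr // ler_peMr ?lerDl // ltW.
have bnd j : inner (c j) y <= inner (c j) (lamk - e *: c k) + m.
  rewrite -lerBlDl -innerBr.
  apply: (@le_trans _ _ (\sum_(l < L) m / (1 + L%:R))).
    apply: ler_sum => l _; apply: le_trans (yl l).
    apply: (@le_trans _ _ (c j 0 l * `|lamk 0 l - e * c k 0 l - y 0 l|)).
      by apply: ler_wpM2l => //; rewrite !mxE distrC ler_norm.
    by rewrite ler_piMl.
  rewrite sumr_const card_ord -[leLHS]mulr_natl mulrCA -[leRHS]mulr1 ler_pM2l //.
  by rewrite ler_pdivrMr // mul1r lerDr.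
apply/capacityP; split => [l|j].
- have := small l; rewrite ler_norml => /andP[_ h].
  have := dl l; have : e * c k 0 l <= e * 1 by rewrite ler_pM2l.
  lra.
- have := bnd j; rewrite innerBr innerZr; have [->|jk] := eqVneq j k.
    by rewrite cc facet_lamk.2; lra.
  have := dj j jk.
  have : 0 <= e * inner (c j) (c k) by rewrite mulr_ge0 ?inner_nneg // ltW.
  by lra.
Unshelve. all: by end_near. Qed.

End Facet.

(** * Drift of MaxWeight *)

Section Average.
Context {R : realType} {A : finType} (p : A -> R).
Hypotheses (p0 : forall a, 0 <= p a) (p1 : \sum_a p a = 1).

Definition avg (f : A -> R) : R := \sum_a p a * f a.

Lemma avgD f g : avg (fun a => f a + g a) = avg f + avg g.
Proof. by rewrite /avg -big_split; apply: eq_bigr => a _; rewrite mulrDr. Qed.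

Lemma avgZ k f : avg (fun a => k * f a) = k * avg f.
Proof. by rewrite /avg mulr_sumr; apply: eq_bigr => a _; rewrite mulrCA. Qed.

Lemma avgB f g : avg (fun a => f a - g a) = avg f - avg g.
Proof. by rewrite /avg -sumrB; apply: eq_bigr => a _; rewrite mulrBr. Qed.

Lemma avg_cst k : avg (fun=> k) = k.
Proof. by rewrite /avg -mulr_suml p1 mul1r. Qed.

Lemma le_avg f g : (forall a, f a <= g a) -> avg f <= avg g.
Proof. by move=> fg; apply: ler_sum => a _; rewrite ler_wpM2l. Qed.

Lemma avg_sum (I : finType) (f : I -> A -> R) :
  avg (fun a => \sum_i f i a) = \sum_i avg (f i).
Proof.
rewrite /avg exchange_big; apply: eq_bigr => a _.
by rewrite mulr_sumr.
Qed.

End Average.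

(** Arrivals bounded by [Amax] are encoded in the finite type [services L Amax], so that one-slot
    expectations are finite sums and [service_vec] also gives their real vectors. *)
Definition qembed (L Amax : nat) (a : services L Amax) : queues L :=
  [ffun l => nat_of_ord (a l)].

Lemma qembed_inj (L Amax : nat) : injective (@qembed L Amax).
Proof.
move=> a a' /ffunP aa'; apply/ffunP => l; apply/val_inj.
by have := aa' l; rewrite !ffunE.
Qed.

Definition qstep (L Smax : nat) (q a : queues L) (s : services L Smax) :
    queues L :=
  [ffun l => (q l + a l - s l)%N].

Lemma inner_queue_ge0 (R : realType) (L : nat) (c : 'rV[R]_L) (q : queues L) :
  (forall l, 0 <= c 0 l) -> 0 <= inner c (queue_vec R q).
Proof. by move=> c0; apply: inner_nneg => // l; rewrite mxE. Qed.

Section Drift.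
Context {R : realType} {L Smax Amax : nat}.
Variables (Ss : {set services L Smax}) (c lamk : 'rV[R]_L) (b delta : R).
Hypotheses (cc : inner c c = 1) (c0 : forall l, 0 <= c 0 l)
  (lamkb : inner c lamk = b)
  (Ssb : forall s, s \in Ss -> inner c (service_vec R s) <= b)
  (delta0 : 0 < delta)
  (ball : forall e : 'rV[R]_L, inner c e = 0 -> inner e e <= 1 ->
     capacity_region Ss (lamk + delta *: e)).

(** A linear functional on a convex hull is bounded by its maximum over the generators. *)
Lemma argmax_weight_max q s (r : 'rV[R]_L) :
  s \in argmax_weight Ss q -> capacity_region Ss r ->
  inner (queue_vec R q) r <= inner (queue_vec R q) (service_vec R s).
Proof.
have wE s' : inner (queue_vec R q) (service_vec R s') = (weight q s')%:R.
  by rewrite /weight natr_sum; apply: eq_bigr => l _; rewrite !mxE natrM.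
rewrite inE => /andP[_ /forallP smax] [n [v [w [vS w0 w1 ->]]]].
rewrite inner_sumr -[leRHS]mul1r -w1 mulr_suml; apply: ler_sum => i _.
rewrite ler_wpM2l //; have [s' /= s'S <-] := vS i.
by rewrite !wE ler_nat; have := smax s'; rewrite s'S.
Qed.

Lemma lamk_capacity : capacity_region Ss lamk.
Proof.
have inner0 (x : 'rV[R]_L) : inner x 0 = 0 by rewrite -(scale0r 0) innerZr mul0r.
by rewrite -[lamk]addr0 -(scaler0 _ delta); apply: ball; rewrite inner0.
Qed.

Definition perp (x : 'rV[R]_L) : 'rV[R]_L := x - inner c x *: c.

Definition perp2 x : R := inner (perp x) (perp x).

Lemma inner_perp x : inner c (perp x) = 0.
Proof. by rewrite /perp innerBr innerZr cc mulr1 subrr. Qed.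

Lemma inner_perpl x y : inner (perp x) y = inner x y - inner c x * inner c y.
Proof. by rewrite /perp innerBl innerZl. Qed.

Lemma perp2E x : perp2 x = inner x x - inner c x ^+ 2.
Proof.
by rewrite /perp2 inner_perpl inner_perp mulr0 subr0 innerC inner_perpl expr2.
Qed.

Lemma perpD x y : perp (x + y) = perp x + perp y.
Proof. by rewrite /perp innerDr scalerDl opprD addrACA. Qed.

Lemma perp2D x y :
  perp2 (x + y) = perp2 x + 2 * inner (perp x) (perp y) + perp2 y.
Proof.
rewrite /perp2 perpD; move: (perp x) (perp y) => {}x {}y.
by rewrite innerDl !innerDr (innerC y x); ring.
Qed.

Lemma perp2_ge0 x : 0 <= perp2 x.
Proof. exact: inner_ge0. Qed.

Lemma perp2_le x : perp2 x <= inner x x.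
Proof. by rewrite perp2E lerBlDr lerDl sqr_ge0. Qed.

(** * One slot of the dynamics, for a fixed arrival and service *)

Section Step.
Variables (q : queues L) (a : services L Amax) (s : services L Smax).
Let vq := queue_vec R q.
Let vq' := queue_vec R (qstep q (qembed a) s).
Let va := service_vec R a.
Let vs := service_vec R s.
Let u := vq' - (vq + va - vs).
Let D : R := Amax%:R + Smax%:R.
Let E : R := L%:R * D ^+ 2.

Let z := Num.sqrt (perp2 vq).
Let cS : R := \sum_l (c 0 l)^-1.

Lemma queue_vec_ge0 l : 0 <= vq 0 l.
Proof. by rewrite mxE. Qed.

Lemma qstepE l : vq' 0 l = Num.max 0 (vq 0 l + va 0 l - vs 0 l).
Proof.
rewrite !mxE !ffunE; have [le|lt] := leqP (s l) (q l + a l).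
  by rewrite natrB // natrD max_r // subr_ge0 -natrD ler_nat.
rewrite (eqP (ltnW lt)) max_l // subr_le0 -natrD ler_nat; exact: ltnW.
Qed.

Lemma arrival_bounds l : 0 <= va 0 l <= Amax%:R.
Proof. by rewrite mxE ler0n ler_nat -ltnS ltn_ord. Qed.

Lemma service_bounds l : 0 <= vs 0 l <= Smax%:R.
Proof. by rewrite mxE ler0n ler_nat -ltnS ltn_ord. Qed.

Lemma unusedE l : u 0 l = vq' 0 l - (vq 0 l + va 0 l - vs 0 l).
Proof. by rewrite !mxE. Qed.

Lemma unused_bounds l : 0 <= u 0 l <= Smax%:R.
Proof.
rewrite unusedE qstepE; have := queue_vec_ge0 l; have := arrival_bounds l.
have := service_bounds l; rewrite maxEle; case: ifPn => ?; lra.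
Qed.

(** Service is wasted only at a queue that ends the slot empty. *)
Lemma unused_orthogonal l : vq' 0 l * u 0 l = 0.
Proof.
rewrite unusedE qstepE maxEle; case: ifPn => _; first by rewrite subrr mulr0.
by rewrite mul0r.
Qed.

Lemma inner_sq_bound (v : 'rV[R]_L) : (forall l, `|v 0 l| <= D) -> inner v v <= E.
Proof.
move=> vD; rewrite /E mulr_natl -[X in _ *+ X]card_ord -sumr_const.
apply: ler_sum => l _; rewrite -expr2 -real_normK ?num_real //.
by rewrite lerXn2r ?nnegrE ?addr_ge0 // vD.
Qed.

Lemma queue_increment_bound : inner (vq' - vq) (vq' - vq) <= E.
Proof.
apply: inner_sq_bound => l; rewrite mxE [X in _ + X]mxE qstepE.
have := queue_vec_ge0 l; have := arrival_bounds l; have := service_bounds l.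
by rewrite ler_norml /D maxEle; case: ifPn => ?; lra.
Qed.

Lemma net_arrival_bound : inner (va - vs) (va - vs) <= E.
Proof.
apply: inner_sq_bound => l; rewrite mxE [X in _ + X]mxE.
have := arrival_bounds l; have := service_bounds l.
by rewrite ler_norml /D; lra.
Qed.

Lemma increment_bound_ge0 : 0 <= E.
Proof. exact: le_trans (inner_ge0 _) net_arrival_bound. Qed.

Lemma norm_qstep : inner vq' vq' <= inner (vq + va - vs) (vq + va - vs).
Proof.
apply: ler_sum => l _; rewrite qstepE !mxE.
by rewrite maxEle; case: ifPn => // _; rewrite mul0r -expr2 sqr_ge0.
Qed.

Lemma inner_qstep :
  inner c vq' = inner c vq + inner c va - inner c vs + inner c u.
Proof. by rewrite /u !(innerBr, innerDr); ring. Qed.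

Lemma inner_unused_ge0 : 0 <= inner c u.
Proof. by apply: inner_nneg => // l; case/andP: (unused_bounds l). Qed.

(* As [x / 0 = 0], coordinates with [c 0 l = 0] do not enter [cS]; they do not
   contribute to the left-hand side either. *)
Lemma unused_cross r : 0 < r ->
  2 * (inner c vq' * inner c u) <=
  r * perp2 vq' + Smax%:R * cS * inner c u / r.
Proof.
move=> r0; rewrite /perp2 /inner -/(inner c vq') -/(inner c u).
rewrite mulr_sumr [r * _]mulr_sumr [_ * cS * _]mulr_sumr mulr_suml -big_split.
rewrite mulr_sumr; apply: ler_sum => l _ /=.
set p := perp vq' 0 l.
have [ul0 ulS] := andP (unused_bounds l).
have cS0 l' : 0 <= (c 0 l')^-1 by rewrite invr_ge0.
have [cl0|cl] := eqVneq (c 0 l) 0.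
  rewrite cl0 !(mul0r, mulr0) addr0 mulr_ge0 ?(ltW r0) //.
  by rewrite -expr2 sqr_ge0.
have clS : (c 0 l)^-1 <= cS.
  by rewrite /cS (bigD1 l) //= lerDl sumr_ge0.
(* Since [vq' 0 l * u 0 l = 0], the unbounded factor [inner c vq'] can be exchanged for the
   orthogonal component [p]. *)
have -> : inner c vq' * (c 0 l * u 0 l) = - (p * u 0 l).
  have pE : p = vq' 0 l - inner c vq' * c 0 l by rewrite /p !mxE.
  by rewrite pE mulrBl unused_orthogonal; ring.
have h1 : - (2 * (p * u 0 l)) <= r * (p * p) + u 0 l ^+ 2 / r.
  have := sqr_ge0 (r * p + u 0 l) => h.
  have -> : r * (p * p) + u 0 l ^+ 2 / r =
    - (2 * (p * u 0 l)) + (r * p + u 0 l) ^+ 2 / r by field; rewrite gt_eqF.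
  by rewrite lerDl divr_ge0 // ltW.
rewrite mulrN; apply: le_trans h1 _; rewrite lerD2l ler_pM2r ?invr_gt0 //.
have cpos : 0 < c 0 l by rewrite lt_neqAle eq_sym cl c0.
have -> : u 0 l ^+ 2 = u 0 l * (c 0 l)^-1 * (c 0 l * u 0 l) by field.
apply: ler_wpM2r; first by rewrite mulr_ge0 // ltW.
by apply: ler_pM.
Qed.

Lemma perp2_qstep : perp2 vq' <= 2 * perp2 vq + 2 * E.
Proof.
have h := le_trans (perp2_le (vq' - vq)) queue_increment_bound.
have := perp2D vq (vq' - vq); rewrite [vq + _]addrC subrK => ->.
have := inner_AMGM (perp vq) (perp (vq' - vq)) (@ltr01 R).
by rewrite -/(perp2 _) -/(perp2 _) divr1; lra.
Qed.

Lemma perp2_drift : perp2 vq' - perp2 vq <= 2 * inner (perp vq) (va - vs) + E.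
Proof.
have h1 := norm_qstep; have h2 := net_arrival_bound.
have -> : perp2 vq' - perp2 vq =
  inner vq' vq' - inner vq vq - (inner c vq' ^+ 2 - inner c vq ^+ 2).
  by rewrite !perp2E; ring.
rewrite -addrA !(innerDl vq) !(innerDr vq) (innerDr _ vq) (innerC _ vq) in h1.
rewrite inner_perpl innerBr.
have h3 : 0 <= inner c vq * inner c u by rewrite mulr_ge0 ?inner_queue_ge0 ?inner_unused_ge0.
have h4 := sqr_ge0 (inner c vq' - inner c vq).
have h5 : 2 * (inner c vq * (inner c va - inner c vs)) <=
   inner c vq' ^+ 2 - inner c vq ^+ 2.
  have e : inner c va - inner c vs = inner c vq' - inner c vq - inner c u.
    by rewrite inner_qstep; ring.
  rewrite e; nra.
rewrite !innerBr in h1 h2 *.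
rewrite !innerNr in h1.
lra.
Qed.

(** The second-order term in the expansion of [y ^+ 2]. By Cauchy-Schwarz it grows only linearly in
    [y], hence loses to the power 3/2 gained from MaxWeight. *)
Lemma perp2_diff_sq : (perp2 vq' - perp2 vq) ^+ 2 <= 8 * E * perp2 vq + 2 * E ^+ 2.
Proof.
have h := le_trans (perp2_le (vq' - vq)) queue_increment_bound.
have := perp2D vq (vq' - vq); rewrite [vq + _]addrC subrK => ->.
rewrite addrAC [_ - _]addrAC subrr add0r.
have := inner_CS (perp vq) (perp (vq' - vq)); rewrite -/(perp2 _) -/(perp2 _).
have := perp2_ge0 (vq' - vq); have := perp2_ge0 vq.
set y := perp2 vq; set w := perp2 _ in h *; set i := inner _ _.
move=> y0 w0 hi.
have h1 : y * w <= y * E by rewrite ler_wpM2l.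
have h2 : w ^+ 2 <= E ^+ 2 by rewrite lerXn2r // nnegrE increment_bound_ge0.
have := sqr_ge0 (2 * i - w); nra.
Qed.

Section MaxWeight.
Hypothesis smax : s \in argmax_weight Ss q.
Let beta := b - inner c vs.

Lemma service_slack_ge0 : 0 <= beta.
Proof. by rewrite subr_ge0 Ssb //; move: smax; rewrite inE => /andP[]. Qed.

Lemma service_slack_le : beta <= b.
Proof.
rewrite lerBlDr lerDl; apply: inner_nneg => // l.
by case/andP: (service_bounds l).
Qed.

(** The chosen service is compared with the point of the region at distance [delta] from [lamk] in
    the direction of [perp vq]. Passing from [perp vq] to [vq] costs nothing, because the service
    has nonnegative slack along [c]. When [perp vq] vanishes there is no direction to normalise and
    [lamk] itself is the competitor. *)
Lemma maxweight_perp : inner (perp vq) (lamk - vs) <= - (delta * z).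
Proof.
have y0 := perp2_ge0 vq.
have z0 : 0 <= z by rewrite sqrtr_ge0.
have zz : z ^+ 2 = perp2 vq by rewrite sqr_sqrtr.
have h : inner (perp vq) (lamk - vs) <= inner vq (lamk - vs).
  rewrite inner_perpl lerBlDr lerDl mulr_ge0 ?inner_queue_ge0 //.
  by rewrite innerBr lamkb service_slack_ge0.
apply: le_trans h _.
have [zE|zn] := eqVneq z 0.
  rewrite zE mulr0 oppr0 innerBr subr_le0.
  exact: argmax_weight_max smax lamk_capacity.
have zp : 0 < z by rewrite lt_neqAle eq_sym zn.
have := argmax_weight_max smax (@ball (z^-1 *: perp vq) _ _).
rewrite innerZr inner_perp mulr0 innerZl innerZr -/(perp2 vq) -zz.
have -> : z^-1 * (z^-1 * z ^+ 2) = 1 by field.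
move=> /(_ erefl (lexx _)).
rewrite innerDr !innerZr innerC -/vq (innerC vq (perp vq)) inner_perpl -expr2.
rewrite -perp2E -zz innerBr (innerC lamk).
have -> : delta * (z^-1 * z ^+ 2) = delta * z by field.
by rewrite -/vs; lra.
Qed.

(* Services on the face have zero slack and are discarded by [x / 0 = 0]. *)
Lemma slack_cross r : 0 < r ->
  2 * (inner c vq * beta) <= r * perp2 vq +
    (\sum_(s' in Ss) inner (service_vec R s' - lamk) (service_vec R s' - lamk) /
       (b - inner c (service_vec R s'))) * beta / r.
Proof.
move=> r0; set K2 := \sum_(s' in _) _.
have sS : s \in Ss by move: smax; rewrite inE => /andP[].
have term0 s' : s' \in Ss ->
    0 <= inner (service_vec R s' - lamk) (service_vec R s' - lamk) /
       (b - inner c (service_vec R s')).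
  by move=> s'S; rewrite divr_ge0 ?inner_ge0 // subr_ge0 Ssb.
have K20 : 0 <= K2 by exact: sumr_ge0.
have := service_slack_ge0; rewrite le_eqVlt => /predU1P[<-|bp].
  by rewrite !(mulr0,mul0r) addr0 mulr_ge0 ?perp2_ge0 // ltW.
(* Maximality of [s] against [lamk] exchanges the unbounded [inner c vq] for the orthogonal
   component. *)
have h : inner c vq * beta <= inner (perp vq) (vs - lamk).
  have := maxweight_perp; have : 0 <= delta * z.
    by rewrite mulr_ge0 ?sqrtr_ge0 // ltW.
  rewrite !inner_perpl !innerBr lamkb => h1 h2.
  have h3 := argmax_weight_max smax lamk_capacity.
  rewrite /beta; lra.
have := inner_AMGM (perp vq) (vs - lamk) r0; rewrite -/(perp2 vq) => h2.
suff : inner (vs - lamk) (vs - lamk) / r <= K2 * beta / r by lra.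
rewrite ler_pM2r ?invr_gt0 //.
(* The ratio of squared distance to slack at [s] is one of the finitely many summands of [K2]. *)
rewrite -ler_pdivrMr // /K2 (bigD1 s) //= -/vs -/beta lerDl.
by apply: sumr_ge0 => s' /andP[s'S _]; exact: term0.
Qed.

End MaxWeight.
End Step.

Definition lyapunov (C r : R) (q : queues L) : R :=
  inner c (queue_vec R q) ^+ 2 - C / r * inner c (queue_vec R q) +
  3 * r * perp2 (queue_vec R q) ^+ 2.

Let D : R := Amax%:R + Smax%:R.
Let E : R := L%:R * D ^+ 2.
Let K2 : R := \sum_(s' in Ss)
  inner (service_vec R s' - lamk) (service_vec R s' - lamk) /
    (b - inner c (service_vec R s')).
Let K3 : R := Smax%:R * \sum_l (c 0 l)^-1.
(** [K2] and [K3] pay for [slack_cross] and [unused_cross]; [b] pays for the squared slack, through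
    [beta ^+ 2 <= b * beta]. *)
Let C := b + K2 + K3.

(** The two cases meet at the crossover [z = k / (4 * delta)]; it is applied to [z ^+ 2 = y]. *)
Lemma cubic_dominates_square (k z : R) : 0 <= k -> 0 <= z ->
  k * z ^+ 2 <= 4 * delta * z ^+ 3 + k * (k / (4 * delta)) ^+ 2.
Proof.
move=> k0 z0; have d0 : 0 < 4 * delta by rewrite mulr_gt0.
have [h|h] := leP z (k / (4 * delta)).
  have h2 : z ^+ 2 <= (k / (4 * delta)) ^+ 2.
    by rewrite lerXn2r ?nnegrE ?divr_ge0 // ltW.
  have := ler_wpM2l k0 h2; have : 0 <= 4 * delta * z ^+ 3.
    by rewrite mulr_ge0 ?exprn_ge0 // ltW.
  by lra.
have h2 : k <= z * (4 * delta) by rewrite -ler_pdivrMr // ltW.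
have := ler_wpM2r (sqr_ge0 z) h2.
have -> : z * (4 * delta) * z ^+ 2 = 4 * delta * z ^+ 3 by ring.
have : 0 <= k * (k / (4 * delta)) ^+ 2 by rewrite mulr_ge0 ?sqr_ge0.
by lra.
Qed.

(** [C5] bounds the drift bracket of [y ^+ 2] by [C5 - y]: the errors have slope [10 * E] in [y],
    and the extra 1 produces [- y]. [C6] collects the remainders of order [r]: [eps ^+ 2 <= r], the
    [2 * E] from the next [y], [C * eps / r = C * r], and [3 * C5]. *)
Let C5 : R := 2 * E ^+ 2 + (10 * E + 1) * ((10 * E + 1) / (4 * delta)) ^+ 2.
Let C6 : R := 1 + 2 * E + C + 3 * C5.

Section AverageDrift.
Variables (p : services L Amax -> R) (zeta eps : R).
Hypotheses (p0 : forall a, 0 <= p a) (p1 : \sum_a p a = 1).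
Let lam := lamk - eps *: c.
Hypotheses (pmean : forall y, avg p (fun a => inner y (service_vec R a)) = inner y lam)
  (pvar : avg p (fun a => (inner c (service_vec R a) - inner c lam) ^+ 2) = zeta).

Lemma lyapunov_drift q s (r : R) : s \in argmax_weight Ss q ->
  0 < r -> r <= 1 -> eps = r ^+ 2 ->
  avg p (fun a => lyapunov C r (qstep q (qembed a) s)) <=
  lyapunov C r q - 2 * eps * inner c (queue_vec R q) + zeta + C6 * r.
Proof.
move=> smax r0 r1 epsE.
set x := inner c (queue_vec R q); set y := perp2 (queue_vec R q).
have y0 : 0 <= y := perp2_ge0 _.
set z := Num.sqrt y; have z0 : 0 <= z by exact: sqrtr_ge0.
have zz : z ^+ 2 = y by rewrite sqr_sqrtr.
pose beta := b - inner c (service_vec R s).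
have beta0 : 0 <= beta := service_slack_ge0 smax.
have betab : beta <= b := service_slack_le _.
have E0 : 0 <= E by apply: mulr_ge0 => //; exact: sqr_ge0.
have xbeta : 2 * (x * beta) <= r * y + K2 * beta / r := slack_cross smax r0.
have mz : inner (perp (queue_vec R q)) (lamk - service_vec R s) <= - (delta * z) :=
  maxweight_perp smax.
have clam : inner c lam = b - eps by rewrite /lam innerBr innerZr cc lamkb mulr1.
have eps0 : 0 <= eps by rewrite epsE sqr_ge0.
pose m := inner (perp (queue_vec R q)) (lamk - service_vec R s).
pose xi (a : services L Amax) : R := inner c (service_vec R a) - inner c lam.
pose eta (a : services L Amax) : R := inner (perp (queue_vec R q)) (service_vec R a) -
  inner (perp (queue_vec R q)) lam.
have xi_mean : avg p xi = 0 by rewrite /xi avgB pmean avg_cst // subrr.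
have eta_mean : avg p eta = 0 by rewrite /eta avgB pmean avg_cst // subrr.
have plam : inner (perp (queue_vec R q)) lam = inner (perp (queue_vec R q)) lamk.
  by rewrite /lam innerBr innerZr (innerC _ c) inner_perp mulr0 subr0.
(* [A0] does not depend on the arrival. The rest is linear in the centred variables [xi] and [eta],
   except for [xi ^+ 2], whose average is exactly [zeta]. *)
pose A0 := lyapunov C r q + 2 * x * (beta - eps) + (beta - eps) ^+ 2 +
  r * (2 * y + 2 * E) - C / r * (beta - eps) +
  3 * r * (4 * y * m + 10 * E * y + 2 * E ^+ 2).
apply: (@le_trans _ _ (avg p (fun a => A0 + (2 * x + 2 * (beta - eps) - C / r) * xi a
     + xi a ^+ 2 + 12 * r * y * eta a))).
  apply: le_avg => // a.
  have := @unused_cross q a s r r0; have := perp2_qstep q a s.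
  have := perp2_drift q a s; have := perp2_diff_sq q a s.
  have := inner_qstep q a s; have := inner_unused_ge0 q a s.
  rewrite -/E -/D -/K3 -/E -/x -/y /lyapunov.
  set x' := inner c (queue_vec R (qstep q (qembed a) s)).
  set y' := perp2 (queue_vec R (qstep q (qembed a) s)).
  set ups := inner c (_ - _).
  have -> : inner (perp (queue_vec R q)) (service_vec R a - service_vec R s) =
      eta a + m.
    by rewrite /eta /m plam !innerBr; ring.
  have -> : x + inner c (service_vec R a) - inner c (service_vec R s) + ups =
      x + xi a + (beta - eps) + ups.
    by rewrite /xi clam /beta; ring.
  move=> ups0 x'E sqd drift step cross.
  rewrite /A0 /lyapunov -/x -/y.
  (* [10 * E] is [2 * E] from [perp2_drift] plus [8 * E] from [perp2_diff_sq]. *)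
  have h1 : 3 * r * (y' ^+ 2 - y ^+ 2) <=
      3 * r * (4 * y * m + 10 * E * y + 2 * E ^+ 2) + 12 * r * y * eta a.
    have -> : 3 * r * (4 * y * m + 10 * E * y + 2 * E ^+ 2) + 12 * r * y * eta a =
       3 * r * (2 * y * (2 * (eta a + m) + E) + (8 * E * y + 2 * E ^+ 2)) by ring.
    apply: ler_wpM2l; first by rewrite mulr_ge0 // ltW.
    have -> : y' ^+ 2 - y ^+ 2 = 2 * y * (y' - y) + (y' - y) ^+ 2 by ring.
    by apply: lerD => //; apply: ler_wpM2l => //; rewrite mulr_ge0.
  have h2 : r * y' <= r * (2 * y + 2 * E) by rewrite ler_pM2l.
  have h3 : K3 * ups / r <= C / r * ups.
    rewrite mulrAC ler_wpM2r // ler_pM2r ?invr_gt0 // /C.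
    rewrite lerDr addr_ge0 //; first exact: le_trans betab.
    apply: sumr_ge0 => s' s'S; rewrite divr_ge0 ?inner_ge0 // subr_ge0.
    exact: Ssb.
  (* [x' - ups] is the value along [c] before truncation at 0. *)
  have h4 : x' ^+ 2 <= (x + xi a + (beta - eps)) ^+ 2 + 2 * (x' * ups).
    have -> : x + xi a + (beta - eps) = x' - ups by rewrite x'E; ring.
    have := sqr_ge0 ups; lra.
  have h5 : C / r * x' = C / r * (x + xi a + (beta - eps)) + C / r * ups.
    by rewrite x'E; ring.
  lra.
have -> A1 A2 A3 : avg p (fun a => A1 + A2 * xi a + xi a ^+ 2 + A3 * eta a) =
    A1 + zeta.
  by rewrite !avgD !avgZ xi_mean eta_mean avg_cst // !mulr0 !addr0 pvar.
have ->: lyapunov C r q - 2 * eps * x + zeta + C6 * r =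
  lyapunov C r q + (- 2 * eps * x + C6 * r) + zeta by ring.
rewrite lerD2r /A0; move: (lyapunov C r q) => V.
have h1 : (beta - eps) ^+ 2 <= b * beta / r + eps ^+ 2.
  have hb : beta * beta <= b * beta by rewrite ler_wpM2r.
  have hr : b * beta <= b * beta / r.
    rewrite ler_peMr ?invf_ge1 // mulr_ge0 //; exact: le_trans betab.
  have := mulr_ge0 beta0 eps0; nra.
have h2 : C / r * eps = C * r by rewrite epsE; field; rewrite gt_eqF.
have h3 : 0 <= K3 * beta / r.
  rewrite divr_ge0 ?(ltW r0) // mulr_ge0 // mulr_ge0 // sumr_ge0 // => l _.
  by rewrite invr_ge0.
have h4 : eps ^+ 2 <= r.
  rewrite epsE -exprM; have : r ^+ 4 <= r ^+ 1 by rewrite ler_wiXn2l // ltW.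
  by rewrite expr1.
have h5 : 4 * y * m + 10 * E * y + 2 * E ^+ 2 <= C5 - y.
  have hk : 0 <= 10 * E + 1 by lra.
  have := cubic_dominates_square hk z0; rewrite zz => h.
  have : 4 * y * m <= 4 * y * - (delta * z) by rewrite ler_wpM2l // mulr_ge0.
  have -> : 4 * y * - (delta * z) = - (4 * delta * z ^+ 3) by rewrite -zz; ring.
  rewrite /C5; lra.
have h6 : 3 * r * (4 * y * m + 10 * E * y + 2 * E ^+ 2) <= 3 * r * (C5 - y).
  by apply: ler_wpM2l h5; rewrite mulr_ge0 // ltW.
have h7 : C / r * (beta - eps) = b * beta / r + K2 * beta / r + K3 * beta / r - C * r.
  by rewrite mulrBr h2 /C; ring.
rewrite h7 /C6; lra.
Qed.

End AverageDrift.
End Drift.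

(** * Laws of countably valued variables and of the arrivals *)

Section CountablyValued.
Context {d : measure_display} {T : measurableType d} {V : countType}.
Variable W : T -> V.
Hypothesis mW : forall v, measurable (W @^-1` [set v]).

Lemma countable_preimage (Y : set V) : measurable (W @^-1` Y).
Proof.
have -> : W @^-1` Y = \bigcup_n [set w | Y (W w) /\ pickle (W w) = n].
  apply/seteqP; split => [w Yw|w [n _ []//]].
  by exists (pickle (W w)).
apply: bigcupT_measurable => n.
have [[w [Yw nE]]|nex] := pselect (exists w, Y (W w) /\ pickle (W w) = n).
  suff -> : [set w | Y (W w) /\ pickle (W w) = n] = W @^-1` [set W w] by [].
  apply/seteqP; split => [w' [_ wn]|w' /= ->//].
  by apply: (pcan_inj pickleK); rewrite wn nE.
suff -> : [set w | Y (W w) /\ pickle (W w) = n] = set0 by [].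
by apply/seteqP; split => // w h; apply: nex; exists w.
Qed.

Lemma countable_measurable_fun d' (U : measurableType d') (D : set T) (g : V -> U) :
  measurable D -> measurable_fun D (g \o W).
Proof.
move=> mD _ Y mY; apply: measurableI => //.
exact: (countable_preimage (g @^-1` Y)).
Qed.

(** Here [k v] acts as the conditional probability of [E] given [W = v]. Both integrands are
    constant on the countably many level sets of [W], where the identity is checked. *)
Lemma countable_integral_transfer (R : realType)
    (P : {measure set T -> \bar R}) (E : set T) (k g : V -> \bar R) :
  measurable E -> (forall v, 0 <= k v)%E -> (forall v, 0 <= g v)%E ->
  (forall v, P (E `&` W @^-1` [set v]) = (k v * P (W @^-1` [set v]))%E) ->
  (\int[P]_(w in E) g (W w) = \int[P]_w (g (W w) * k (W w)))%E.
Proof.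
move=> mE k0 g0 PE.
pose F n := W @^-1` [set v | pickle v = n].
have mF n : measurable (F n) by exact: countable_preimage.
have tF : trivIset setT F by move=> i j _ _ [w [<- <-]].
have cover : \bigcup_n F n = setT.
  by apply/seteqP; split => // w _; exists (pickle (W w)).
have mg h D : measurable D -> measurable_fun D (fun w => h (W w) : \bar R).
  exact: countable_measurable_fun.
have -> : E = \bigcup_n (E `&` F n) by rewrite -setI_bigcupr cover setIT.
rewrite ge0_integral_bigcup //=; last 3 first.
- by move=> n; exact: measurableI.
- by apply: mg; apply: bigcupT_measurable => n; exact: measurableI.
- by move=> i j _ _ [w [[_ <-] [_ <-]]].
rewrite -cover ge0_integral_bigcup //=; last 2 first.
- by apply: (mg (fun v => g v * k v)%E); apply: bigcupT_measurable.
- by move=> w _; rewrite mule_ge0.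
apply: eq_eseriesr => n _.
have [[w wn]|nex] := pselect (exists w, F n w); last first.
  have -> : F n = set0 by apply/seteqP; split => // w h; apply: nex; exists w.
  by rewrite setI0 !integral_set0.
have -> : F n = W @^-1` [set W w].
  apply/seteqP; split => [w' wn'|w' /= wE]; last by rewrite /F /= wE.
  by apply: (pcan_inj pickleK); rewrite wn' wn.
rewrite (eq_integral (cst (g (W w)))); last first.
  by move=> w'; rewrite inE => -[_ /= ->].
rewrite integral_cst; last by apply: measurableI.
rewrite [RHS](eq_integral (cst (g (W w) * k (W w))%E)); last first.
  by move=> w'; rewrite inE /= => ->.
by rewrite integral_cst // -muleA PE.
Qed.

End CountablyValued.

Lemma ge0_integral_finite_cover d (T : measurableType d) (R : realType)
    (P : {measure set T -> \bar R}) (I : finType) (F : I -> set T)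
    (f : T -> \bar R) :
  (forall i, measurable (F i)) -> trivIset setT F ->
  P (~` \bigcup_i F i) = 0%E -> measurable_fun setT f ->
  (forall x, 0 <= f x)%E ->
  (\int[P]_x f x = \sum_i \int[P]_(x in F i) f x)%E.
Proof.
move=> mF tF null mf f0.
have bE : \bigcup_i F i = \big[setU/set0]_(i : I) F i.
  rewrite -bigcup_seq; apply/seteqP.
  by split => x [i _ Fi]; exists i => //=; rewrite mem_index_enum.
have mU : measurable (\bigcup_i F i).
  by rewrite bE; exact: bigsetU_measurable.
rewrite -(setUv (\bigcup_i F i)) ge0_integral_setU //; last 3 first.
- exact: measurableC.
- exact: measurable_funS mf.
- by apply/disj_setPCl.
rewrite [X in (_ + X)%E]null_set_integral //; last 2 first.
- exact: measurableC.
- exact: measurable_funS mf.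
rewrite adde0 bE ge0_integral_bigsetU //.
- exact: index_enum_uniq.
- exact: sub_trivIset tF.
- by apply: measurable_funS mf => //.
Qed.

(** * Bounded arrivals as a finite product law *)

Section ArrivalLaw.
Context {R : realType} {L Amax : nat}.
Variable (nu : 'I_L -> probability nat R).

Definition arrival_weight (l : 'I_L) (j : 'I_Amax.+1) : R :=
  fine (nu l [set nat_of_ord j]).

Definition arrival_pmf (a : services L Amax) : R :=
  \prod_l arrival_weight l (a l).

Lemma arrival_weight_ge0 l j : 0 <= arrival_weight l j.
Proof. by rewrite fine_ge0. Qed.

Lemma arrival_weightE l j :
  nu l [set nat_of_ord j] = (arrival_weight l j)%:E.
Proof. by rewrite fineK // fin_num_measure. Qed.

Lemma arrival_pmf_ge0 a : 0 <= arrival_pmf a.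
Proof. by apply: prodr_ge0 => l _; exact: arrival_weight_ge0. Qed.

Lemma arrival_pmfE (a : services L Amax) :
  (\prod_(l < L) nu l [set nat_of_ord (a l)])%E = (arrival_pmf (a : services L Amax))%:E.
Proof.
rewrite /arrival_pmf -prodEFin; apply: eq_bigr => l _.
exact: arrival_weightE.
Qed.

Lemma sum_arrival_pmf_prod (F : 'I_L -> 'I_Amax.+1 -> R) :
  \sum_a arrival_pmf a * \prod_l F l (a l) =
  \prod_l \sum_j arrival_weight l j * F l j.
Proof.
rewrite bigA_distr_bigA; apply: eq_bigr => a _.
by rewrite -big_split.
Qed.

Hypothesis bounded : forall l, nu l [set n | (n <= Amax)%N] = 1%E.

Lemma arrival_integral l (f : nat -> R) : (forall n, 0 <= f n) ->
  (\int[nu l]_n (f n)%:E)%E =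
  (\sum_(j < Amax.+1) arrival_weight l j * f j)%:E.
Proof.
move=> f0.
rewrite (@ge0_integral_finite_cover _ _ _ _ 'I_Amax.+1 (fun j => [set nat_of_ord j])) //.
- rewrite -sumEFin; apply: eq_bigr => j _.
  rewrite (eq_integral (cst (f j)%:E)); last by move=> n; rewrite inE /= => ->.
  rewrite integral_cst // mulrC EFinM -arrival_weightE.
  by congr (_ * _)%E.
- by move=> i j _ _ [n [/= -> /ord_inj]].
- have -> : \bigcup_(j in [set: 'I_Amax.+1]) [set nat_of_ord j] =
      [set n | (n <= Amax)%N].
    apply/seteqP; split => [n [j _ ->]|n /= nA].
      by rewrite /= -ltnS.
    by exists (Ordinal (nA : (n < Amax.+1)%N)).
  by etransitivity; [exact: probability_setC|rewrite bounded subee].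
Qed.

Lemma sum_arrival_weight l : \sum_j arrival_weight l j = 1.
Proof.
have := @arrival_integral l (fun=> 1) (fun=> ler01).
rewrite integral_cst // mul1e => h.
transitivity (\sum_j arrival_weight l j * 1).
  by apply: eq_bigr => j _; rewrite mulr1.
by apply/EFin_inj; rewrite -h; exact: probability_setT.
Qed.

Lemma sum_arrival_pmf : \sum_a arrival_pmf a = 1.
Proof.
transitivity (\sum_a arrival_pmf a * \prod_(l < L) (1 : R)).
  by apply: eq_bigr => a _; rewrite big1_eq mulr1.
rewrite (sum_arrival_pmf_prod (fun _ _ => 1)) big1 // => l _.
by rewrite -[RHS](sum_arrival_weight l); apply: eq_bigr => j _; rewrite mulr1.
Qed.

(** Padding the other coordinates with the factor 1 turns the average into a product of one-queue
    sums. *)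
Lemma avg_arrival_coord l (f : 'I_Amax.+1 -> R) :
  avg arrival_pmf (fun a => f (a l)) = \sum_j arrival_weight l j * f j.
Proof.
pose F i j := if i == l then f j else 1.
transitivity (\sum_a arrival_pmf a * \prod_i F i (a i)).
  apply: eq_bigr => a _; rewrite (bigD1 l) //= {1}/F eqxx big1 ?mulr1 //.
  by move=> i /negPf il; rewrite /F il.
rewrite sum_arrival_pmf_prod (bigD1 l) //= /F eqxx [X in _ * X]big1 ?mulr1 //.
move=> i /negPf ->; rewrite -[RHS](sum_arrival_weight i).
by apply: eq_bigr => j _; rewrite mulr1.
Qed.

Lemma avg_arrival_coord2 l m (f g : 'I_Amax.+1 -> R) : l != m ->
  avg arrival_pmf (fun a => f (a l) * g (a m)) =
  (\sum_j arrival_weight l j * f j) * (\sum_j arrival_weight m j * g j).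
Proof.
move=> lm; have ml : (m == l) = false by rewrite eq_sym; exact/negbTE.
pose F i j := if i == l then f j else if i == m then g j else 1.
transitivity (\sum_a arrival_pmf a * \prod_i F i (a i)).
  apply: eq_bigr => a _; rewrite (bigD1 l) //= (bigD1 m) //=; last by rewrite ml.
  rewrite {1 2}/F ml !eqxx big1 ?mulr1 // => i /andP[/negPf il /negPf im].
  by rewrite /F il im.
rewrite sum_arrival_pmf_prod (bigD1 l) //= (bigD1 m) //=; last by rewrite ml.
rewrite /F ml !eqxx [X in _ * (_ * X)]big1 ?mulr1 //.
move=> i /andP[/negPf -> /negPf ->]; rewrite -[RHS](sum_arrival_weight i).
by apply: eq_bigr => j _; rewrite mulr1.
Qed.

Variables (lam : 'rV[R]_L) (sigma : 'I_L -> R).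
Hypotheses
  (mean : forall l, ('E_(nu l)[fun n => n%:R%R] = (lam 0 l)%:E :> \bar R)%E)
  (var : forall l,
     variance (nu l) (fun n => n%:R) = (sigma l ^+ 2)%:E :> \bar R).

Lemma sum_arrival_mean l :
  \sum_(j < Amax.+1) arrival_weight l j * j%:R = lam 0 l.
Proof.
have := mean l; rewrite unlock arrival_integral; last by move=> n; exact: ler0n.
by case.
Qed.

Lemma sum_arrival_variance l :
  \sum_(j < Amax.+1) arrival_weight l j * (j%:R - lam 0 l) ^+ 2 = sigma l ^+ 2.
Proof.
have := var l; rewrite /variance covariance.unlock mean /= expectation.unlock.
rewrite (arrival_integral _ (f := fun n => (n%:R - lam 0 l) ^+ 2)).
  by case.
by move=> n; exact: sqr_ge0.
Qed.

Lemma avg_arrival_mean (y : 'rV[R]_L) :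
  avg arrival_pmf (fun a => inner y (service_vec R a)) = inner y lam.
Proof.
rewrite /inner avg_sum; apply: eq_bigr => l _; rewrite avgZ; congr (_ * _).
rewrite -sum_arrival_mean -(avg_arrival_coord l (fun j => j%:R)).
by apply: eq_bigr => a _; rewrite mxE.
Qed.

(** In the expanded square, the cross terms of distinct queues vanish by independence and
    centring. *)
Lemma avg_arrival_variance (y : 'rV[R]_L) :
  avg arrival_pmf (fun a => (inner y (service_vec R a) - inner y lam) ^+ 2) =
  zeta y sigma.
Proof.
pose f l (j : 'I_Amax.+1) : R := y 0 l * (j%:R - lam 0 l).
have fE l m : avg arrival_pmf (fun a => f l (a l) * f m (a m)) =
    if l == m then y 0 l ^+ 2 * sigma l ^+ 2 else 0.
  have [<-|lm] := eqVneq l m.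
    rewrite (avg_arrival_coord l (fun j => f l j * f l j)) -sum_arrival_variance.
    by rewrite mulr_sumr; apply: eq_bigr => j _; rewrite /f; ring.
  rewrite avg_arrival_coord2 //.
  suff -> : \sum_j arrival_weight l j * f l j = 0 by rewrite mul0r.
  transitivity (y 0 l * (\sum_(j < Amax.+1) arrival_weight l j * j%:R -
     (\sum_j arrival_weight l j) * lam 0 l)).
    rewrite mulr_suml -sumrB mulr_sumr; apply: eq_bigr => j _; rewrite /f; ring.
  by rewrite sum_arrival_mean sum_arrival_weight mul1r subrr mulr0.
transitivity (\sum_l \sum_m avg arrival_pmf (fun a => f l (a l) * f m (a m))).
  under eq_bigr do rewrite -avg_sum.
  rewrite -avg_sum; apply: eq_bigr => a _; congr (_ * _).
  rewrite -innerBr expr2 /inner mulr_suml; apply: eq_bigr => l _.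
  rewrite mulr_sumr; apply: eq_bigr => m _.
  by rewrite /f !mxE.
apply: eq_bigr => l _; rewrite (bigD1 l) //= fE eqxx big1 ?addr0 // => m ml.
by rewrite fE eq_sym (negPf ml).
Qed.

End ArrivalLaw.

(** * Stationarity *)

(** The transition operator of the MaxWeight chain, acting on functions of the queue. *)
Definition mwstep (R : realType) (L Smax Amax : nat) (Ss : {set services L Smax})
    (p : services L Amax -> R) (h : queues L -> R) (q : queues L) : R :=
  \sum_(s in argmax_weight Ss q)
    #|argmax_weight Ss q|%:R^-1 * avg p (fun a => h (qstep q (qembed a) s)).

Section MaxWeightChain.
Context {R : realType} {L Smax : nat}.
Variables (Ss : {set services L Smax}) (nu : 'I_L -> probability nat R)
  (X : queue_process R L Smax).
Local Notation P := (qp_prob X).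

Definition argmax_weight_prob (q : queues L) (s : services L Smax) : R :=
  if s \in argmax_weight Ss q then #|argmax_weight Ss q|%:R^-1 else 0.

Lemma argmax_weight_prob_ge0 q s : 0 <= argmax_weight_prob q s.
Proof. by rewrite /argmax_weight_prob; case: ifP. Qed.

Lemma iid_arrivals_law (iid : iid_arrivals nu X) t a :
  P (arrival X t @^-1` [set a]) = (\prod_(l < L) nu l [set a l])%E.
Proof.
have := iid t.+1 (fun u l => if u == t then [set a l] else setT).
rewrite big_ord_recr /= eqxx big1 ?mul1e; last first.
  move=> i _; rewrite big1 // => l _.
  by rewrite (ltn_eqF (ltn_ord i)) probability_setT.
move=> <-; congr (P _); apply/seteqP; split => [w /= <- u l _|w /= h].
  by case: eqP => [->|].
by apply/ffunP => l; have := h t l (ltnSn t); rewrite eqxx.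
Qed.

Lemma past_measurable t q a s : measurable (past (X := X) t q a s).
Proof.
have -> : past (X := X) t q a s =
    (\bigcap_(u in [set u | (u <= t)%N]) queue X u @^-1` [set q u]) `&`
    \bigcap_(u in [set u | (u < t)%N])
      (arrival X u @^-1` [set a u] `&` service X u @^-1` [set s u]).
  by [].
apply: measurableI; apply: bigcap_measurableType => u _.
- exact: queue_measurable.
- apply: measurableI; [exact: arrival_measurable|exact: service_measurable].
Qed.

Section History.
Variable t : nat.

(** The MaxWeight law conditions on the whole past; coding it as one countably valued variable makes
    the discrete transfer of integrals applicable. *)
Definition history (w : qp_space X) :
    {ffun 'I_t.+1 -> queues L} * {ffun 'I_t -> queues L * services L Smax} :=
  ([ffun u : 'I_t.+1 => queue X u w],
   [ffun u : 'I_t => (arrival X u w, service X u w)]).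

Lemma history_last w : (history w).1 ord_max = queue X t w.
Proof. by rewrite ffunE. Qed.

(** [past] reads arrivals and services only before [t], so the values at [t] are free and carry the
    pair whose conditional probability is wanted. *)
Lemma history_preimage w0 (a : queues L) (s : services L Smax) :
  history @^-1` [set history w0] =
  past (X := X) t (queue X ^~ w0)
    (fun u => if (u < t)%N then arrival X u w0 else a)
    (fun u => if (u < t)%N then service X u w0 else s).
Proof.
apply/seteqP; split => [w /= [/ffunP hq /ffunP ha]|w [hq ha]].
  split => [u ut|u ut].
    by have := hq (Ordinal (ut : (u < t.+1)%N)); rewrite !ffunE.
  by rewrite ut; have := ha (Ordinal ut); rewrite !ffunE => -[].
rewrite /= /history; congr pair; apply/ffunP => u; rewrite !ffunE.
  by rewrite hq // -ltnS.
by have := ha u (ltn_ord u); rewrite ltn_ord => -[-> ->].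
Qed.

Lemma history_measurable v : measurable (history @^-1` [set v]).
Proof.
have [[w0 <-]|nex] := pselect (exists w0, history w0 = v).
  have := @history_preimage w0 [ffun=> 0%N] [ffun=> ord0] => ->.
  exact: past_measurable.
suff -> : history @^-1` [set v] = set0 by [].
by apply/seteqP; split => // w h; apply: nex; exists w.
Qed.

(** The Markov property: given the history, the probability of the pair [(s, a)] depends on the
    current queue only. *)
Lemma maxweight_joint_law (mw : maxweight Ss nu X) s a (g : queues L -> \bar R) :
  (forall q, 0 <= g q)%E ->
  (\int[P]_(w in service X t @^-1` [set s] `&` arrival X t @^-1` [set a])
     g (queue X t w) =
   \int[P]_w (g (queue X t w) * ((argmax_weight_prob (queue X t w) s)%:E *
     \prod_(l < L) nu l [set a l])))%E.
Proof.
move=> g0; have [[iid _ _] law] := mw.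
under eq_integral do rewrite -history_last.
under [RHS]eq_integral do rewrite -history_last.
apply: (@countable_integral_transfer _ _ _ history history_measurable _ _ _
  (fun v => ((argmax_weight_prob (v.1 ord_max) s)%:E *
     \prod_(l < L) nu l [set a l])%E) (fun v => g (v.1 ord_max))).
- by apply: measurableI; [exact: service_measurable|exact: arrival_measurable].
- move=> v; rewrite mule_ge0 ?lee_fin ?argmax_weight_prob_ge0 //.
  by apply: prode_ge0 => l _; exact: measure_ge0.
- by move=> v.
- move=> v.
  have [[w0 <-]|nex] := pselect (exists w0, history w0 = v); last first.
    have -> : history @^-1` [set v] = set0.
      by apply/seteqP; split => // w h; apply: nex; exists w.
    by rewrite setI0 measure0 mule0.
  rewrite history_last.
  pose q := queue X ^~ w0.
  pose a' u := if (u < t)%N then arrival X u w0 else a.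
  pose s' u := if (u < t)%N then service X u w0 else s.
  have [] := law t q a' s'.
  have -> : a' t = a by rewrite /a' ltnn.
  have -> : s' t = s by rewrite /s' ltnn.
  rewrite (iid_arrivals_law iid) => -> h.
  have -> : history @^-1` [set history w0] = past (X := X) t q a' s'.
    exact: history_preimage.
  rewrite setIC setIA; etransitivity; first exact: h.
  by rewrite -muleA muleC.
Qed.

End History.

Variable Amax : nat.
Hypothesis bounded : forall l, nu l [set n | (n <= Amax)%N] = 1%E.

Lemma maxweight_step (mw : maxweight Ss nu X) t (h : queues L -> R) :
  (forall q, 0 <= h q) ->
  (\int[P]_w (h (queue X t.+1 w))%:E =
   \int[P]_w (mwstep Ss (arrival_pmf (Amax := Amax) nu) h (queue X t w))%:E)%E.
Proof.
move=> h0; have [[iid inSs dyn] _] := mw.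
pose F (i : services L Smax * services L Amax) :=
  service X t @^-1` [set i.1] `&` arrival X t @^-1` [set qembed i.2].
have mF i : measurable (F i).
  by apply: measurableI; [exact: service_measurable|exact: arrival_measurable].
have mq (f : queues L -> \bar R) u : measurable_fun setT (fun w => f (queue X u w)).
  exact: (countable_measurable_fun (@queue_measurable R L Smax X u)).
have tF : trivIset setT F.
  by move=> [s a] [s' a'] _ _ [w [[/= <- wa] [/= <- wa']]];
    congr pair; apply: qembed_inj; rewrite -wa -wa'.
(* Outside these events some arrival exceeds [Amax]; the probabilities of the arrival vectors in the
   box already sum to 1. *)
have null : P (~` \bigcup_i F i) = 0%E.
  pose D := [set` index_enum (services L Amax)].
  have -> : \bigcup_i F i = \bigcup_(a in D) (arrival X t @^-1` [set qembed a]).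
    apply/seteqP; split => [w [[s a] _ [_ wa]]|w [a _ wa]].
      by exists a => //; rewrite /D /= mem_index_enum.
    by exists (service X t w, a).
  have mA (a : services L Amax) : measurable (arrival X t @^-1` [set qembed a]).
    exact: arrival_measurable.
  have finD : finite_set D by exact: finite_seq.
  rewrite probability_setC; last exact: fin_bigcup_measurable.
  rewrite measure_fin_bigcup //; last first.
    by move=> a a' _ _ [w [/= -> /qembed_inj]].
  rewrite -fsbig_seq ?index_enum_uniq //.
  rewrite (eq_bigr (fun a => (arrival_pmf nu a)%:E)) => [|a _].
    have -> : (1 = \sum_(a : services L Amax) (arrival_pmf nu a)%:E :> \bar R)%E.
      by rewrite sumEFin sum_arrival_pmf.
    by rewrite subee // sumEFin.
  rewrite -arrival_pmfE.
  transitivity (\prod_(l < L) nu l [set qembed a l])%E.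
    exact: (iid_arrivals_law iid).
  by apply: eq_bigr => l _; rewrite ffunE.
rewrite (ge0_integral_finite_cover mF tF null); last 2 first.
- exact: (mq (fun q => (h q)%:E)).
- by move=> w; rewrite lee_fin.
transitivity (\sum_(i : services L Smax * services L Amax)
  \int[P]_w ((h (qstep (queue X t w) (qembed i.2) i.1) *
    (argmax_weight_prob (queue X t w) i.1 * arrival_pmf nu i.2))%:E))%E.
  apply: eq_bigr => -[s a] _ /=.
  have law := @maxweight_joint_law t mw s (qembed a)
    (fun q => (h (qstep q (qembed a) s))%:E).
  transitivity (\int[P]_(w in F (s, a)) (h (qstep (queue X t w) (qembed a) s))%:E)%E.
    apply: eq_integral => w; rewrite inE => -[/= ws wa].
    congr (h _)%:E.
    by apply/ffunP => l; rewrite dyn ffunE ws wa.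
  rewrite law => [|q]; last by rewrite lee_fin.
  apply: eq_integral => w _.
  rewrite EFinM EFinM -arrival_pmfE; congr (_ * (_ * _))%E.
  by apply: eq_bigr => l _; rewrite ffunE.
rewrite -ge0_integral_sum //; last 2 first.
- move=> i; exact: (mq (fun q => (h (qstep q (qembed i.2) i.1) *
    (argmax_weight_prob q i.1 * arrival_pmf nu i.2))%:E)).
- by move=> i w _; rewrite lee_fin !mulr_ge0 ?argmax_weight_prob_ge0 ?arrival_pmf_ge0.
apply: eq_integral => w _; rewrite sumEFin; congr EFin.
rewrite /mwstep [RHS]big_mkcond /= -(pair_bigA _ (fun s a =>
  h (qstep (queue X t w) (qembed a) s) *
    (argmax_weight_prob (queue X t w) s * arrival_pmf nu a))) /=.
apply: eq_bigr => s _; rewrite /argmax_weight_prob; case: ifP => _.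
  by rewrite /avg mulr_sumr; apply: eq_bigr => a _; ring.
by rewrite big1 // => a _; ring.
Qed.

End MaxWeightChain.

(** * Expectations under the limit law *)

Section MeanQueue.
Context {R : realType} {L : nat}.
Variable Q : random_queue R L.

Definition qmean (h : queues L -> R) : \bar R :=
  (\int[rq_prob Q]_w (h (rq_val w))%:E)%E.

Lemma rq_measurable_fun (h : queues L -> \bar R) :
  measurable_fun setT (fun w : rq_space Q => h (rq_val w)).
Proof. exact: (countable_measurable_fun (@rq_measurable R L Q)). Qed.

Lemma qmean_ge0 h : (forall q, 0 <= h q) -> (0 <= qmean h)%E.
Proof. by move=> h0; apply: integral_ge0 => w _; rewrite lee_fin. Qed.

Lemma le_qmean f g : (forall q, 0 <= f q) -> (forall q, f q <= g q) ->
  (qmean f <= qmean g)%E.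
Proof.
move=> f0 fg; apply: ge0_le_integral => //.
- by move=> w _; rewrite lee_fin.
- exact: (rq_measurable_fun (fun q => (f q)%:E)).
- exact: (rq_measurable_fun (fun q => (g q)%:E)).
- by move=> w _; rewrite lee_fin.
Qed.

Lemma qmeanD f g : (forall q, 0 <= f q) -> (forall q, 0 <= g q) ->
  qmean (fun q => f q + g q) = (qmean f + qmean g)%E.
Proof.
move=> f0 g0; rewrite /qmean; under eq_integral do rewrite EFinD.
apply: ge0_integralD => //.
- by move=> w _; rewrite lee_fin.
- exact: (rq_measurable_fun (fun q => (f q)%:E)).
- by move=> w _; rewrite lee_fin.
- exact: (rq_measurable_fun (fun q => (g q)%:E)).
Qed.

Lemma qmeanZ k f : 0 <= k -> (forall q, 0 <= f q) ->
  qmean (fun q => k * f q) = (k%:E * qmean f)%E.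
Proof.
move=> k0 f0; rewrite /qmean; under eq_integral do rewrite EFinM.
apply: ge0_integralZl => //.
- exact: (rq_measurable_fun (fun q => (f q)%:E)).
- by move=> w _; rewrite lee_fin.
Qed.

Lemma qmean_cst k : qmean (fun=> k) = k%:E.
Proof.
by rewrite /qmean integral_cst // [X in (_ * X)%E]probability_setT mule1.
Qed.

Lemma qmean_min_cvg (h : queues L -> R) : (forall q, 0 <= h q) ->
  qmean (fun q => Num.min (h q) n%:R) @[n --> \oo] --> qmean h.
Proof.
move=> h0.
have nd q : {homo (fun n => (Num.min (h q) n%:R)%:E) : n m / (n <= m)%N >->
    (n <= m)%E}.
  move=> n m nm; rewrite lee_fin le_min !ge_min lexx /=.
  by apply/orP; right; rewrite ler_nat.
have := @cvg_monotone_convergence _ _ _ (rq_prob Q) setT measurableT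
  (fun n w => (Num.min (h (rq_val w)) n%:R)%:E)
  (fun n => rq_measurable_fun (fun q => (Num.min (h q) n%:R)%:E)).
have -> : (fun w : rq_space Q => limn (fun n => (Num.min (h (rq_val w)) n%:R)%:E)) =
    (fun w => (h (rq_val w))%:E).
  apply/funext => w; apply/cvg_lim => //.
  apply: cvg_near_cst; exists (Num.truncn (h (rq_val w))).+1 => //= n /= hn.
  rewrite min_l //; apply: le_trans (ltW (truncnS_gt _)) _.
  by rewrite ler_nat.
apply.
- by move=> n w _; rewrite lee_fin le_min h0 /=.
- by move=> w _; exact: nd.
Qed.

Hypothesis fm : finite_moments Q.

(** Fourth moments suffice because the Lyapunov function has degree four in the queue. *)
Lemma qmean_quartic_fin (A B : R) : 0 <= A -> 0 <= B ->
  (qmean (fun q => (A + B * \sum_(l < L) (q l)%:R ^+ 4)%R) < +oo)%E.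
Proof.
move=> A0 B0.
have q0 q : 0 <= \sum_(l < L) (q l)%:R ^+ 4 :> R.
  by apply: sumr_ge0 => l _; rewrite exprn_ge0.
rewrite qmeanD // => [|q]; last exact: mulr_ge0.
rewrite qmean_cst qmeanZ // lte_add_pinfty ?ltry //.
apply: lte_mul_pinfty => //.
rewrite /qmean; under eq_integral do rewrite -sumEFin.
rewrite ge0_integral_sum //; last first.
- by move=> l; exact: (rq_measurable_fun (fun q => ((q l)%:R ^+ 4)%:E)).
apply/lte_sum_pinfty => l _.
have := fm (fun l' => if l' == l then 4%N else 0%N); rewrite unlock.
set f := (X in (integral _ _ X < _)%E -> _).
suff -> : f = (fun w => ((rq_val w l)%:R ^+ 4)%:E) by [].
apply/funext => w; rewrite /f (bigD1 l) //= eqxx big1 ?mulr1 // => i /negPf ->.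
by rewrite expr0.
Qed.

End MeanQueue.

Lemma mean_innerE (R : realType) (L : nat) (c : 'rV[R]_L) (Q : random_queue R L) :
  mean_inner c Q = qmean Q (fun q => inner c (queue_vec R q)).
Proof. by rewrite /mean_inner expectation.unlock. Qed.

Lemma argmax_weight_exists (L Smax : nat) (Ss : {set services L Smax}) s0 q :
  s0 \in Ss -> exists s, s \in argmax_weight Ss q.
Proof.
move=> s0S; case: (arg_maxnP (weight q) s0S) => s sS smax.
exists s; rewrite inE; apply/andP; split => //; apply/forallP => s'; apply/implyP => s'S.
exact: smax.
Qed.

Section Stationary.
Context {R : realType} {L Smax Amax : nat}.
Variables (Ss : {set services L Smax}) (s0 : services L Smax).
Hypothesis s0S : s0 \in Ss.

Lemma mwstep_le (p : services L Amax -> R) h q K :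
  (forall s, s \in argmax_weight Ss q ->
     avg p (fun a => h (qstep q (qembed a) s)) <= K) ->
  mwstep Ss p h q <= K.
Proof.
move=> hK; have [s sm] := argmax_weight_exists q s0S.
have n0 : 0 < #|argmax_weight Ss q|%:R :> R.
  by rewrite ltr0n; apply/card_gt0P; exists s.
apply: (@le_trans _ _ (\sum_(s in argmax_weight Ss q)
    #|argmax_weight Ss q|%:R^-1 * K)).
  by apply: ler_sum => s' s'm; rewrite ler_wpM2l ?invr_ge0 ?(ltW n0) ?hK.
by rewrite sumr_const -mulrnAl -mulr_natl divff ?mul1r // gt_eqF.
Qed.

Lemma mwstep_ge0 (p : services L Amax -> R) h q :
  (forall a, 0 <= p a) -> (forall q', 0 <= h q') -> 0 <= mwstep Ss p h q.
Proof.
move=> p0 h0; apply: sumr_ge0 => s _; rewrite mulr_ge0 ?invr_ge0 //.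
by apply: sumr_ge0 => a _; rewrite mulr_ge0.
Qed.

Lemma le_mwstep (p : services L Amax -> R) f g q :
  (forall a, 0 <= p a) -> (forall q', f q' <= g q') ->
  mwstep Ss p f q <= mwstep Ss p g q.
Proof.
move=> p0 fg; apply: ler_sum => s _; rewrite ler_wpM2l ?invr_ge0 //.
exact: le_avg.
Qed.

Variables (nu : 'I_L -> probability nat R) (X : queue_process R L Smax)
  (Q : random_queue R L).
Hypotheses (bounded : forall l, nu l [set n | (n <= Amax)%N] = 1%E)
  (mw : maxweight Ss nu X) (cvgQ : converges_in_distribution X Q).
Local Notation p := (@arrival_pmf R L Amax nu).

(** The mean of [h] at time [t.+1] equals that of [mwstep] at time [t]; both sequences converge in
    the limit law, and limits are unique. *)
Lemma stationary_bounded h M : (forall q, 0 <= h q <= M) ->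
  qmean Q h = qmean Q (mwstep Ss p h).
Proof.
move=> hM; have h0 q : 0 <= h q by case/andP: (hM q).
have p0 := @arrival_pmf_ge0 R L Amax nu.
have bh : exists M : R, forall q, `|h q| <= M.
  by exists M => q; rewrite ger0_norm //; case/andP: (hM q).
have bP : exists M : R, forall q, `|mwstep Ss p h q| <= M.
  exists M => q; rewrite ger0_norm ?mwstep_ge0 //; apply: mwstep_le => s _.
  rewrite -[leRHS](avg_cst (sum_arrival_pmf bounded)).
  by apply: le_avg => // a; case/andP: (hM (qstep q (qembed a) s)).
have c1 := cvgQ bh; have c2 := cvgQ bP.
rewrite -(cvg_shiftS (fun t => _)) in c1.
move: c1 c2; rewrite !expectation.unlock => c1 c2.
apply: (cvg_unique (@ereal_hausdorff R) _ c2).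
apply: cvg_trans c1; apply: near_eq_cvg; apply: nearW => t /=.
by rewrite (maxweight_step bounded mw).
Qed.

(** Truncation at [n] and monotone convergence extend stationarity to unbounded [h] as an
    inequality, in the direction that the drift argument uses. *)
Lemma stationary_le h : (forall q, 0 <= h q) ->
  (qmean Q h <= qmean Q (mwstep Ss p h))%E.
Proof.
move=> h0; have p0 := @arrival_pmf_ge0 R L Amax nu.
have c := qmean_min_cvg (Q := Q) h0.
rewrite -(cvg_lim _ c) //; apply: lime_le; first by apply/cvg_ex; eexists; exact: c.
apply: nearW => n.
have hn q : 0 <= Num.min (h q) n%:R <= n%:R.
  by rewrite ge_min lexx orbT andbT le_min h0 /=.
rewrite (stationary_bounded hn); apply: le_qmean.
  by move=> q; apply: mwstep_ge0 => // q'; case/andP: (hn q').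
by move=> q; apply: le_mwstep => // q'; rewrite ge_min lexx.
Qed.

End Stationary.

(** * Upper bound for MaxWeight, uniform in the arrival law *)

Section UpperBound.
Context {R : realType} {L Smax Amax : nat}.
Variables (Ss : {set services L Smax}) (s0 : services L Smax)
  (c lamk : 'rV[R]_L) (b delta : R).
Hypotheses (s0S : s0 \in Ss) (cc : inner c c = 1) (c0 : forall l, 0 <= c 0 l)
  (lamkb : inner c lamk = b)
  (Ssb : forall s, s \in Ss -> inner c (service_vec R s) <= b)
  (delta0 : 0 < delta)
  (ball : forall e : 'rV[R]_L, inner c e = 0 -> inner e e <= 1 ->
     capacity_region Ss (lamk + delta *: e)).

(** Cauchy-Schwarz between the squared queue lengths and the all-ones vector. *)
Lemma norm_sq_quartic (q : queues L) :
  inner (queue_vec R q) (queue_vec R q) ^+ 2 <= L%:R * \sum_(l < L) (q l)%:R ^+ 4.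
Proof.
have := inner_CS (\row_l (q l)%:R ^+ 2) (const_mx (1 : R) : 'rV[R]_L).
have -> : inner (\row_l (q l)%:R ^+ 2) (const_mx 1 : 'rV[R]_L) =
    inner (queue_vec R q) (queue_vec R q).
  by apply: eq_bigr => l _; rewrite !mxE mulr1 expr2.
have -> : inner (const_mx 1) (const_mx 1 : 'rV[R]_L) = L%:R.
  rewrite /inner; under eq_bigr do rewrite !mxE mulr1.
  by rewrite sumr_const card_ord.
have -> : inner (\row_l (q l)%:R ^+ 2) (\row_l (q l)%:R ^+ 2) =
    \sum_(l < L) (q l)%:R ^+ 4 :> R.
  by apply: eq_bigr => l _; rewrite !mxE -exprD.
by rewrite mulrC.
Qed.

Lemma inner_queue_quartic (q : queues L) :
  inner c (queue_vec R q) <= 2 + L%:R * \sum_(l < L) (q l)%:R ^+ 4.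
Proof.
have := norm_sq_quartic q; set n := inner _ _.
have := perp2_ge0 c (queue_vec R q); rewrite (perp2E cc) -/n.
set x := inner c _ => h1 h2.
have := sqr_ge0 (1 - x); have := sqr_ge0 (1 - n); nra.
Qed.

(** Completing the square in [x]. The shift yields a nonnegative function, to which [stationary_le]
    applies. *)
Lemma lyapunov_lb C r q : 0 < r -> 0 <= lyapunov c C r q + (C / r) ^+ 2 / 4.
Proof.
move=> r0; rewrite /lyapunov; set x := inner c _; set k := C / r.
have : 0 <= 3 * r * perp2 c (queue_vec R q) ^+ 2.
  by rewrite mulr_ge0 ?sqr_ge0 // mulr_ge0 // ltW.
have := sqr_ge0 (x - k / 2); nra.
Qed.

Lemma lyapunov_ub C r q : 0 < r ->
  lyapunov c C r q <= 2 + (C / r) ^+ 2 +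
    (2 + 3 * r) * L%:R * \sum_(l < L) (q l)%:R ^+ 4.
Proof.
move=> r0; have := norm_sq_quartic q; rewrite /lyapunov.
have h := perp2_le cc (queue_vec R q).
have := perp2_ge0 c (queue_vec R q) => h0.
have xn : inner c (queue_vec R q) ^+ 2 <= inner (queue_vec R q) (queue_vec R q).
  by move: h0; rewrite perp2E // subr_ge0.
have yn : perp2 c (queue_vec R q) ^+ 2 <= inner (queue_vec R q) (queue_vec R q) ^+ 2.
  by rewrite lerXn2r ?nnegrE // (le_trans h0).
move: h h0 xn yn; set x := inner c _; set y := perp2 _ _; set n := inner _ _.
set k := C / r => h h0 xn yn hn.
rewrite -mulrA.
have h1 : (2 + 3 * r) * n ^+ 2 <= (2 + 3 * r) * (L%:R * \sum_(l < L) (q l)%:R ^+ 4).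
  by apply: ler_wpM2l => //; rewrite addr_ge0 // mulr_ge0 // ltW.
have h2 : 3 * r * y ^+ 2 <= 3 * r * n ^+ 2.
  by apply: ler_wpM2l => //; rewrite mulr_ge0 // ltW.
have := sqr_ge0 (x + k); have := sqr_ge0 (1 - n); have := sqr_ge0 k; nra.
Qed.

Lemma maxweight_mean_upper : exists2 C', 0 <= C' &
  forall (nu : 'I_L -> probability nat R) (X : queue_process R L Smax)
    (Q : random_queue R L) (sigma : 'I_L -> R) (eps : R),
  0 < eps -> eps <= 1 ->
  (forall l, nu l [set n | (n <= Amax)%N] = 1%E) ->
  (forall l, ('E_(nu l)[fun n => n%:R%R] =
     ((lamk - eps *: c) 0 l)%:E :> \bar R)%E) ->
  (forall l, variance (nu l) (fun n => n%:R) = (sigma l ^+ 2)%:E :> \bar R) ->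
  maxweight Ss nu X -> converges_in_distribution X Q -> finite_moments Q ->
  ((2 * eps)%:E * mean_inner c Q <=
    (zeta c sigma + C' * Num.sqrt eps)%:E)%E.
Proof.
have := fun p : services L Amax -> R =>
  lyapunov_drift cc c0 lamkb Ssb delta0 ball (p := p).
set C := (b + _ + _); set C6 := (1 + _ + _ + _) => drift.
(* [C6] involves only the geometry, [Amax] and [Smax], so one constant serves all arrival laws and
   all [eps]. *)
exists `|C6| => // nu X Q sigma eps eps0 eps1 bounded mean var mw cvgQ fm.
pose r := Num.sqrt eps.
have r0 : 0 < r by rewrite sqrtr_gt0.
have r1 : r <= 1 by rewrite -sqrtr1 ler_sqrt.
have epsE : eps = r ^+ 2 by rewrite sqr_sqrtr // ltW.
pose p := @arrival_pmf R L Amax nu.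
have p0 : forall a, 0 <= p a := @arrival_pmf_ge0 _ _ _ _.
have p1 : \sum_a p a = 1 := sum_arrival_pmf bounded.
pose G q := lyapunov c C r q + (C / r) ^+ 2 / 4.
have G0 q : 0 <= G q by exact: lyapunov_lb.
have K0 : 0 <= zeta c sigma + `|C6| * r.
  rewrite addr_ge0 //; last by rewrite mulr_ge0 // ltW.
  by apply: sumr_ge0 => l _; rewrite mulr_ge0 ?sqr_ge0.
have stepG q : mwstep Ss p G q + 2 * eps * inner c (queue_vec R q) <=
    G q + (zeta c sigma + `|C6| * r).
  rewrite -lerBrDr; apply: (mwstep_le s0S) => s sm.
  rewrite /G avgD avg_cst //.
  have := drift p (zeta c sigma) eps p0 p1 (avg_arrival_mean bounded mean)
    (avg_arrival_variance bounded mean var c) q s r sm r0 r1 epsE.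
  have : C6 * r <= `|C6| * r by rewrite ler_pM2r ?ler_norm.
  lra.
have x0 q : 0 <= 2 * eps * inner c (queue_vec R q).
  by rewrite mulr_ge0 ?inner_queue_ge0 // mulr_ge0 // ltW.
have P0 q : 0 <= mwstep Ss p G q by exact: mwstep_ge0.
have Gfin : qmean Q G \is a fin_num.
  rewrite ge0_fin_numE ?qmean_ge0 //.
  apply: le_lt_trans (@qmean_quartic_fin _ _ _ fm
    (2 + (C / r) ^+ 2 + (C / r) ^+ 2 / 4) ((2 + 3 * r) * L%:R) _ _).
  - apply: le_qmean => // q; rewrite /G.
    by have := lyapunov_ub C q r0; lra.
  - by have := sqr_ge0 (C / r); lra.
  - by rewrite mulr_ge0 // addr_ge0 // mulr_ge0 // ltW.
rewrite mean_innerE -qmeanZ ?inner_queue_ge0 //; last 2 first.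
- by rewrite mulr_ge0 // ltW.
- by move=> q; exact: inner_queue_ge0.
(* The mean of [G] is finite, so adding it to both sides is reversible; this replaces a subtraction
   of extended reals. *)
rewrite -(@leeD2lE _ (qmean Q G)) // -(qmean_cst Q).
apply: (@le_trans _ _ (qmean Q (mwstep Ss p G) +
   qmean Q (fun q => (2 * eps * inner c (queue_vec R q))%R))%E).
  apply: leeD2r.
  exact: (stationary_le s0S bounded mw cvgQ).
rewrite -(qmeanD Q P0 x0) -(qmeanD Q G0) //; apply: le_qmean => // q.
by rewrite addr_ge0.
Qed.

Lemma mean_inner_fin_num (Q : random_queue R L) : finite_moments Q ->
  mean_inner c Q \is a fin_num.
Proof.
move=> fm; rewrite mean_innerE ge0_fin_numE ?qmean_ge0 //; last first.
  by move=> q; exact: inner_queue_ge0.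
apply: le_lt_trans (@qmean_quartic_fin _ _ _ fm 2 L%:R _ _) => //.
apply: le_qmean => q; [exact: inner_queue_ge0|exact: inner_queue_quartic].
Qed.

End UpperBound.

(** * Lower bound for arbitrary policies *)

(** Beyond [Y] both [y >= 1] and [tau * y >= 1 + b] hold, so the cubic term outweighs the other
    two. *)
Lemma lindley_drift_bounded (R : realType) (b tau : R) : 0 <= b -> 0 < tau ->
  exists B, forall y, 0 <= y -> y ^+ 2 + b * y - tau * y ^+ 3 <= B.
Proof.
move=> b0 tau0; pose Y := 1 + (1 + b) / tau.
have Y0 : 0 <= Y by rewrite addr_ge0 // divr_ge0 ?addr_ge0 // ltW.
have b1 : 0 <= (1 + b) / tau by rewrite divr_ge0 ?addr_ge0 // ltW.
exists (Y ^+ 2 + b * Y) => y y0.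
have t3 : 0 <= tau * y ^+ 3 by rewrite mulr_ge0 ?exprn_ge0 // ltW.
have [yY|Yy] := leP y Y.
  have h1 : y ^+ 2 <= Y ^+ 2 by rewrite lerXn2r.
  have h2 : b * y <= b * Y by rewrite ler_wpM2l.
  lra.
have y1 : 1 <= y by rewrite /Y in Yy; lra.
have h1 : 1 + b <= tau * y.
  by rewrite mulrC -ler_pdivrMr //; rewrite /Y in Yy; lra.
have h2 : (1 + b) * y ^+ 2 <= tau * y * y ^+ 2 by rewrite ler_wpM2r ?sqr_ge0.
have h3 : b * y <= b * y ^+ 2.
  by rewrite ler_wpM2l // expr2 ler_peMr.
have h4 : tau * y * y ^+ 2 = tau * y ^+ 3 by ring.
have h5 : 0 <= Y ^+ 2 + b * Y by rewrite addr_ge0 ?sqr_ge0 ?mulr_ge0.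
lra.
Qed.

Section LowerBound.
Context {R : realType} {L Smax Amax : nat}.
Variables (Ss : {set services L Smax}) (c : 'rV[R]_L) (b : R).
Hypotheses (c0 : forall l, 0 <= c 0 l) (b0 : 0 <= b)
  (Ssb : forall s, s \in Ss -> inner c (service_vec R s) <= b).

Definition lindley_step (y : R) (a : services L Amax) : R :=
  Num.max 0 (y + inner c (service_vec R a) - b).

(** Expectation after [t] steps under independent arrivals. Recursion on the first step fits the
    extension of arrival words in the coupling; [lindley_meanS] supplies the last-step form for the
    drift. *)
Fixpoint lindley_mean (p : services L Amax -> R) (f : R -> R) (t : nat) (y : R) : R :=
  if t is t'.+1 then avg p (fun a => lindley_mean p f t' (lindley_step y a))
  else f y.

Lemma lindley_step_ge0 y a : 0 <= lindley_step y a.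
Proof. by rewrite le_max lexx. Qed.

(** Reflection acts only when [y + d] lies between [- b] and 0. There [(y + d) * (y + d + b)] is
    nonpositive, so replacing it by 0 is a gain, and the cube is at least [- b ^+ 3]. *)
Lemma lindley_step_bounds y a : 0 <= y ->
  let d := inner c (service_vec R a) - b in
  (y + d) ^+ 2 + b * (y + d) <= lindley_step y a ^+ 2 + b * lindley_step y a /\
  lindley_step y a ^+ 3 <= (y + d) ^+ 3 + b ^+ 3.
Proof.
move=> y0 d.
have d0 : - b <= d.
  rewrite /d lerBrDl subrr; apply: inner_nneg => // l; by rewrite mxE.
rewrite /lindley_step -addrA -/d maxEle.
case: ifPn => [h|]; first by rewrite lerDl exprn_ge0.
rewrite -ltNge => h; rewrite !expr0n /= mulr0 addr0; split.
  have : (y + d) * (y + d + b) <= 0.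
    by apply: mulr_le0_ge0; [exact: ltW|lra].
  nra.
have h1 : (- (y + d)) ^+ 3 <= b ^+ 3.
  by rewrite lerXn2r ?nnegrE //; lra.
have -> : (y + d) ^+ 3 = - (- (y + d)) ^+ 3 by ring.
lra.
Qed.

Section Pmf.
Variables (p : services L Amax -> R) (zeta eps : R).
Hypotheses (p0 : forall a, 0 <= p a) (p1 : \sum_a p a = 1) (eps0 : 0 < eps)
  (pmean : avg p (fun a => inner c (service_vec R a)) = b - eps)
  (pvar : avg p (fun a => (inner c (service_vec R a) - (b - eps)) ^+ 2) = zeta).

Lemma le_lindley_mean f g t y : (forall z, 0 <= z -> f z <= g z) -> 0 <= y ->
  lindley_mean p f t y <= lindley_mean p g t y.
Proof.
move=> fg; elim: t y => [|t IH] y y0 /=; first exact: fg.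
by apply: le_avg => // a; apply: IH; exact: lindley_step_ge0.
Qed.

Lemma lindley_meanB f g t y :
  lindley_mean p (fun z => f z - g z) t y =
  lindley_mean p f t y - lindley_mean p g t y.
Proof.
elim: t y => [//|t IH] y /=; rewrite -avgB; apply: eq_bigr => a _.
by rewrite IH.
Qed.

Lemma lindley_meanZ k f t y :
  lindley_mean p (fun z => k * f z) t y = k * lindley_mean p f t y.
Proof.
elim: t y => [//|t IH] y /=; rewrite -avgZ; apply: eq_bigr => a _.
by rewrite IH.
Qed.

Lemma lindley_mean_cst k t y : lindley_mean p (fun=> k) t y = k.
Proof.
elim: t y => [//|t IH] y /=; rewrite -[RHS](avg_cst p1); apply: eq_bigr => a _.
by rewrite IH.
Qed.

Lemma lindley_meanS f t y :
  lindley_mean p f t.+1 y =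
  lindley_mean p (fun z => avg p (fun a => f (lindley_step z a))) t y.
Proof.
elim: t y => [//|t IH] y.
transitivity (avg p (fun a => lindley_mean p f t.+1 (lindley_step y a))) => //.
by apply: eq_bigr => a _; rewrite IH.
Qed.

Lemma lindley_drift : exists Kc, forall tau y, 0 < tau -> 0 <= y ->
  y ^+ 2 + b * y - tau * y ^+ 3 +
    (zeta - b * eps - tau * Kc) - 2 * eps * Num.min y tau^-1 <=
  avg p (fun a => lindley_step y a ^+ 2 + b * lindley_step y a -
                  tau * lindley_step y a ^+ 3).
Proof.
pose d (a : services L Amax) : R := inner c (service_vec R a) - b.
have d1 : avg p d = - eps by rewrite /d avgB pmean avg_cst //; ring.
have d2 : avg p (fun a => d a ^+ 2) = zeta + eps ^+ 2.
  have -> : avg p (fun a => d a ^+ 2) =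
     avg p (fun a => (inner c (service_vec R a) - (b - eps)) ^+ 2 +
        (- 2 * eps * d a - eps ^+ 2)).
    by apply: eq_bigr => a _; rewrite /d; congr (_ * _); ring.
  by rewrite avgD avgB avgZ d1 avg_cst // pvar; ring.
pose E2 := zeta + eps ^+ 2; pose E3 := avg p (fun a => d a ^+ 3).
(* The summands come from the third moment, the reflection and a completed square. The constant may
   blow up with [eps]: it is multiplied by [tau], which tends to 0 for fixed [eps]. *)
exists (`|E3| + b ^+ 3 + 9 * E2 ^+ 2 / (4 * eps)) => tau y tau0 y0.
apply: (@le_trans _ _ (avg p (fun a => (y ^+ 2 + b * y - tau * y ^+ 3 - tau * b ^+ 3) +
    (2 * y + b - 3 * tau * y ^+ 2) * d a + (1 - 3 * tau * y) * d a ^+ 2 -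
    tau * d a ^+ 3))); last first.
  apply: le_avg => // a.
  have [h1 h2] := lindley_step_bounds a y0; rewrite -/(d a) in h1 h2.
  have h3 : tau * lindley_step y a ^+ 3 <= tau * ((y + d a) ^+ 3 + b ^+ 3).
    by rewrite ler_pM2l.
  move: h1 h3; set z := lindley_step y a; set e := d a => h1 h3.
  have -> : y ^+ 2 + b * y - tau * y ^+ 3 - tau * b ^+ 3 +
    (2 * y + b - 3 * tau * y ^+ 2) * e + (1 - 3 * tau * y) * e ^+ 2 - tau * e ^+ 3
    = (y + e) ^+ 2 + b * (y + e) - tau * ((y + e) ^+ 3 + b ^+ 3) by ring.
  lra.
have -> A0 A1 A2 : avg p (fun a => A0 + A1 * d a + A2 * d a ^+ 2 - tau * d a ^+ 3) =
    A0 + A1 * - eps + A2 * E2 - tau * E3.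
  by rewrite avgB !avgD !avgZ avg_cst // d1 d2.
(* The negative drift makes the cubic term contribute [3 * tau * eps * y ^+ 2]: two thirds pay here
   for the truncation, one third absorbs [3 * tau * E2 * y] in [h4]. *)
have hmin : 2 * eps * y - 2 * eps * Num.min y tau^-1 <= 2 * eps * (tau * y ^+ 2).
  rewrite -mulrBr ler_pM2l ?mulr_gt0 // minEle; case: ifPn => h.
    by rewrite subrr mulr_ge0 ?sqr_ge0 // ltW.
  rewrite -ltNge in h; apply: (@le_trans _ _ y).
    by rewrite lerBlDr lerDl invr_ge0 ltW.
  have : 1 <= tau * y by rewrite mulrC -ler_pdivrMr // div1r ltW.
  by move=> h1; have := ler_wpM2r y0 h1; rewrite mul1r expr2 mulrA.
have h3 : tau * E3 <= tau * `|E3| by rewrite ler_pM2l // ler_norm.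
have h4 : tau * (3 * E2 * y) <= tau * (eps * y ^+ 2 + 9 * E2 ^+ 2 / (4 * eps)).
  rewrite ler_pM2l // -subr_ge0.
  have -> : eps * y ^+ 2 + 9 * E2 ^+ 2 / (4 * eps) - 3 * E2 * y =
     eps * (y - 3 * E2 / (2 * eps)) ^+ 2 by field; rewrite gt_eqF.
  by rewrite mulr_ge0 ?sqr_ge0 // ltW.
have := sqr_ge0 eps; have : E2 = zeta + eps ^+ 2 by [].
move: hmin h3 h4; move: (9 * E2 ^+ 2 / _) => W; set Y := Num.min y _; nra.
Qed.

End Pmf.

(** * Comparison of an arbitrary policy with the Lindley recursion *)

Section Coupling.
Variables (nu : 'I_L -> probability nat R) (Y : queue_process R L Smax).
Hypotheses (bounded : forall l, nu l [set n | (n <= Amax)%N] = 1%E)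
  (feas : feasible Ss nu Y).
Local Notation P := (qp_prob Y).
Local Notation p := (@arrival_pmf R L Amax nu).

Definition arrival_word (u : nat) (alpha : nat -> services L Amax) :
    set (qp_space Y) :=
  [set w | forall i, (i < u)%N -> arrival Y i w = qembed (alpha i)].

Lemma arrival_word_measurable u alpha : measurable (arrival_word u alpha).
Proof.
have -> : arrival_word u alpha = \bigcap_(i in [set i | (i < u)%N])
    arrival Y i @^-1` [set qembed (alpha i)] by [].
by apply: bigcap_measurableType => i _; exact: arrival_measurable.
Qed.

Lemma arrival_word_prob u alpha :
  P (arrival_word u alpha) = (\prod_(i < u) p (alpha i))%:E.
Proof.
have [iid _ _] := feas.
have := iid u (fun i l => [set nat_of_ord (alpha i l)]).
rewrite -prodEFin (eq_bigr (fun i : 'I_u => (p (alpha i))%:E)); last first.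
  by move=> i _; rewrite arrival_pmfE.
move=> <-; congr (P _); apply/seteqP; split => [w h i l iu|w h i iu].
  by rewrite /= (h i iu) ffunE.
by apply/ffunP => l; rewrite ffunE; exact: h.
Qed.

Lemma queue_lindley u w a : arrival Y u w = qembed a ->
  lindley_step (inner c (queue_vec R (queue Y u w))) a <=
  inner c (queue_vec R (queue Y u.+1 w)).
Proof.
have [_ inSs dyn] := feas; move=> wa.
have -> : queue Y u.+1 w = qstep (queue Y u w) (qembed a) (service Y u w).
  by apply/ffunP => l; rewrite dyn ffunE wa.
rewrite ge_max; apply/andP; split.
  exact: inner_queue_ge0.
rewrite inner_qstep; have := @inner_unused_ge0 R L Smax Amax c c0 (queue Y u w) a (service Y u w).
by have := Ssb (inSs u w); lra.
Qed.

Lemma lindley_step_mono y y' a : y <= y' -> lindley_step y a <= lindley_step y' a.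
Proof.
move=> yy'; rewrite ge_max le_max lexx /= le_max lerB ?lerD //.
by rewrite orbT.
Qed.

Variable h : R -> R.
Hypotheses (h0 : forall y, 0 <= h y) (hmono : {homo h : y y' / y <= y'}).

Lemma queue_measurable_fun (g : queues L -> \bar R) u D : measurable D ->
  measurable_fun D (fun w => g (queue Y u w)).
Proof. exact: (countable_measurable_fun (@queue_measurable R L Smax Y u)). Qed.

(** Induction on [n], splitting the event by the next arrival. Only events in the arrivals are used,
    as their product law holds for every policy. Restricting to arrivals within [Amax] can only
    lower the integral of the nonnegative [h]. *)
Lemma lindley_coupling n u alpha y :
  (forall w, arrival_word u alpha w -> y <= inner c (queue_vec R (queue Y u w))) ->
  (P (arrival_word u alpha) * (lindley_mean p h n y)%:E <=
   \int[P]_(w in arrival_word u alpha)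
     (h (inner c (queue_vec R (queue Y (u + n) w))))%:E)%E.
Proof.
have mW := arrival_word_measurable.
pose g q : \bar R := (h (inner c (queue_vec R q)))%:E.
have g0 q : (0 <= g q)%E by rewrite lee_fin.
elim: n u alpha y => [|n IH] u alpha y yle.
  rewrite addn0 muleC -integral_cst //; apply: ge0_le_integral => //.
  - by move=> w _; rewrite lee_fin.
  - exact: (queue_measurable_fun g).
  - by move=> w ww; rewrite lee_fin; apply/hmono/yle.
pose ext a i := if i == u then a else alpha i.
have extE a w : arrival_word u.+1 (ext a) w <->
    arrival_word u alpha w /\ arrival Y u w = qembed a.
  split => [ww|[ww wa] i].
    split; last by have := ww u (ltnSn u); rewrite /ext eqxx.
    by move=> i iu; have := ww i (ltnW iu); rewrite /ext (ltn_eqF iu).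
  by rewrite ltnS leq_eqVlt /ext => /predU1P[->|iu]; rewrite ?eqxx ?(ltn_eqF iu) //; exact: ww.
have trivF : trivIset [set: services L Amax] (fun a => arrival_word u.+1 (ext a)).
  by move=> a a' _ _ [w [/extE[_ wa] /extE[_ wa']]];
    apply: qembed_inj; rewrite -wa -wa'.
have Pext a : P (arrival_word u.+1 (ext a)) = (P (arrival_word u alpha) * (p a)%:E)%E.
  rewrite !arrival_word_prob big_ord_recr /= {2}/ext eqxx -EFinM; congr (_ * _)%:E.
  by apply: eq_bigr => i _; rewrite /ext (ltn_eqF (ltn_ord i)).
have mU : measurable (\big[setU/set0]_(a : services L Amax) arrival_word u.+1 (ext a)).
  by apply: bigsetU_measurable => a _; exact: mW.
apply: (@le_trans _ _ (\int[P]_(w in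
    \big[setU/set0]_(a : services L Amax) arrival_word u.+1 (ext a)) g (queue Y (u + n.+1) w))%E);
  last first.
  apply: ge0_subset_integral => //.
  - exact: (queue_measurable_fun g).
  - by rewrite -bigcup_seq => w [a _ /extE[]].
rewrite ge0_integral_bigsetU //; last 3 first.
- exact: index_enum_uniq.
- exact: sub_trivIset trivF.
- exact: (queue_measurable_fun g).
have -> : (P (arrival_word u alpha) * (lindley_mean p h n.+1 y)%:E =
    \sum_a P (arrival_word u.+1 (ext a)) * (lindley_mean p h n (lindley_step y a))%:E)%E.
  rewrite /= /avg -sumEFin ge0_sume_distrr; last first.
    move=> a _; rewrite lee_fin mulr_ge0 ?arrival_pmf_ge0 //.
    rewrite -(lindley_mean_cst (sum_arrival_pmf bounded) 0 n (lindley_step y a)).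
    apply: le_lindley_mean => //; first exact: arrival_pmf_ge0.
    exact: lindley_step_ge0.
  by apply: eq_bigr => a _; rewrite Pext EFinM muleA.
apply: lee_sum => a _; rewrite addnS -addSn; apply: IH => w /extE[ww wa].
apply: le_trans (queue_lindley wa).
by apply: lindley_step_mono; exact: yle.
Qed.

End Coupling.

Lemma lower_mean (nu : 'I_L -> probability nat R) (Y : queue_process R L Smax)
    (Q : random_queue R L) (lam : 'rV[R]_L) (sigma : 'I_L -> R) (eps : R) :
  0 < eps -> inner c lam = b - eps ->
  (forall l, nu l [set n | (n <= Amax)%N] = 1%E) ->
  (forall l, ('E_(nu l)[fun n => n%:R%R] = (lam 0 l)%:E :> \bar R)%E) ->
  (forall l, variance (nu l) (fun n => n%:R) = (sigma l ^+ 2)%:E :> \bar R) ->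
  feasible Ss nu Y -> converges_in_distribution Y Q ->
  ((zeta c sigma - b * eps)%:E <= (2 * eps)%:E * mean_inner c Q)%E.
Proof.
move=> eps0 clam bounded mean var feas cvgQ.
pose p := @arrival_pmf R L Amax nu.
have p0 : forall a, 0 <= p a := @arrival_pmf_ge0 _ _ _ _.
have p1 : \sum_a p a = 1 := sum_arrival_pmf bounded.
have pmean : avg p (fun a => inner c (service_vec R a)) = b - eps.
  by rewrite (avg_arrival_mean bounded mean).
have pvar : avg p (fun a => (inner c (service_vec R a) - (b - eps)) ^+ 2) =
    zeta c sigma.
  by rewrite -clam; exact: (avg_arrival_variance bounded mean var).
have [Kc drift] := lindley_drift p0 p1 eps0 pmean pvar.
have x0 q : 0 <= inner c (queue_vec R q) by exact: inner_queue_ge0.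
have step tau : 0 < tau ->
    ((zeta c sigma - b * eps - tau * Kc)%:E <= (2 * eps)%:E * mean_inner c Q)%E.
  move=> tau0; have M0 : 0 <= tau^-1 by rewrite invr_ge0 ltW.
  (* On [y >= 0] the outer maximum has no effect; it makes [h] nonnegative on all reals, as the
     coupling requires. *)
  pose h y : R := Num.max 0 (Num.min y tau^-1).
  have hE y : 0 <= y -> h y = Num.min y tau^-1.
    by move=> y0; rewrite /h max_r // le_min y0.
  have h0 y : 0 <= h y by rewrite le_max lexx.
  have hM y : h y <= tau^-1 by rewrite ge_max M0 ge_min lexx orbT.
  have hmono : {homo h : y y' / y <= y'}.
    move=> y y' yy'; rewrite ge_max h0 /= le_max; apply/orP; right.
    by rewrite le_min !ge_min yy' lexx orbT.
  pose H q := h (inner c (queue_vec R q)).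
  have H0 q : 0 <= H q by exact: h0.
  have HM q : H q <= tau^-1 by exact: hM.
  have bH : exists M : R, forall q, `|H q| <= M.
    by exists tau^-1 => q; rewrite ger0_norm.
  pose m t := (\int[qp_prob Y]_w (H (queue Y t w))%:E)%E.
  have cvgm : m t @[t --> \oo] --> qmean Q H.
    by have := cvgQ H bH; rewrite !expectation.unlock.
  have mfin : qmean Q H \is a fin_num.
    rewrite ge0_fin_numE ?qmean_ge0 //.
    apply: le_lt_trans (_ : (qmean Q (fun=> tau^-1%R) < +oo)%E).
      by apply: le_qmean.
    by rewrite qmean_cst ltry.
  have muE : qmean Q H = (fine (qmean Q H))%:E by rewrite fineK.
  set mu := fine _ in muE.
  have dom t : ((lindley_mean p h t 0)%:E <= m t)%E.
    have := @lindley_coupling nu Y bounded feas h h0 hmono t 0 (fun=> [ffun=> ord0]) 0.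
    have -> : arrival_word (Y := Y) 0 (fun=> [ffun=> ord0] : services L Amax) = setT.
      by apply/seteqP; split => // w _ i.
    rewrite probability_setT mul1e add0n; apply => w _; exact: x0.
  suff key : zeta c sigma - b * eps - tau * Kc <= 2 * eps * mu.
    apply: (@le_trans _ _ ((2 * eps)%:E * qmean Q H)%E).
      by rewrite muE -EFinM lee_fin.
    rewrite lee_pmul2l ?lte_fin ?mulr_gt0 // mean_innerE.
    by apply: le_qmean => // q; rewrite /H hE // ge_min lexx.
  (* Otherwise the mean [e] of the bounded-above function eventually gains at least [eta] per step.
     Half of the gap, [eta], absorbs the convergence error and the other half is the gain. *)
  rewrite leNgt; apply/negP => lt.
  pose kappa := zeta c sigma - b * eps - tau * Kc.
  pose eta := (kappa - 2 * eps * mu) / 2.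
  have eta0 : 0 < eta by rewrite divr_gt0 // subr_gt0.
  pose f y : R := y ^+ 2 + b * y - tau * y ^+ 3.
  pose e t := lindley_mean p f t 0.
  have [B fB] := lindley_drift_bounded b0 tau0.
  have eB t : e t <= B.
    rewrite -(lindley_mean_cst p1 B t 0); apply: le_lindley_mean => //.
  have inc t : e t + kappa - 2 * eps * lindley_mean p h t 0 <= e t.+1.
    rewrite /e lindley_meanS -(lindley_mean_cst p1 kappa t 0) -lindley_meanZ.
    have -> : lindley_mean p f t 0 + lindley_mean p (fun=> kappa) t 0 =
        lindley_mean p f t 0 - lindley_mean p (fun=> - kappa) t 0.
      by rewrite !(lindley_mean_cst p1) opprK.
    rewrite -!lindley_meanB; apply: le_lindley_mean => // y y0.
    by have := drift tau y tau0 y0; rewrite hE // opprK.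
  have small : \forall t \near \oo, lindley_mean p h t 0 <= mu + eta / (2 * eps).
    have pos : 0 < eta / (2 * eps) by rewrite divr_gt0 // mulr_gt0.
    rewrite muE in cvgm.
    have /cvgm : nbhs mu%:E [set x | (x < (mu + eta / (2 * eps))%:E)%E].
      apply: open_nbhs_nbhs; split; first exact: open_ereal_lt_ereal.
      by rewrite /= lte_fin ltrDl.
    move=> [N _ hN]; exists N => // t /hN mt; rewrite /= -lee_fin.
    exact: le_trans (dom t) (ltW mt).
  have [N _ hN] := small.
  have grow k : e N + k%:R * eta <= e (N + k)%N.
    elim: k => [|k IH]; first by rewrite addn0 mul0r addr0.
    rewrite addnS; apply: le_trans (inc _).
    have h1 := hN (N + k)%N (leq_addr k N).
    have h2 : 2 * eps * lindley_mean p h (N + k) 0 <= 2 * eps * mu + eta.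
      have -> : 2 * eps * mu + eta = 2 * eps * (mu + eta / (2 * eps)).
        by field; rewrite gt_eqF.
      by rewrite ler_pM2l // mulr_gt0.
    have : kappa = 2 * eps * mu + 2 * eta by rewrite /eta; field.
    by rewrite -natr1 mulrDl mul1r; lra.
  have := eB (N + (Num.truncn ((B - e N) / eta)).+1)%N.
  rewrite leNgt => /negP; apply; apply: lt_le_trans (grow _).
  by rewrite -ltrBlDl -ltr_pdivrMr // truncnS_gt.
have := leey (mean_inner c Q); rewrite le_eqVlt => /predU1P[->|mlt].
  by rewrite gt0_muley ?leey // lte_fin mulr_gt0.
have mfin : mean_inner c Q \is a fin_num.
  rewrite ge0_fin_numE // mean_innerE.
  by apply: qmean_ge0 => q; exact: x0.
rewrite -(fineK mfin) -EFinM lee_fin; set mu := fine _.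
have stepr tau : 0 < tau -> zeta c sigma - b * eps - tau * Kc <= 2 * eps * mu.
  by move/step; rewrite -(fineK mfin) -EFinM lee_fin.
rewrite leNgt; apply/negP => lt.
pose g := zeta c sigma - b * eps - 2 * eps * mu.
have g0 : 0 < g by rewrite subr_gt0.
have K0 : 0 < 1 + `|Kc| by rewrite ltr_pwDl.
(* A choice of [tau] for which [tau * Kc] is at most half of the supposed gap [g]. *)
have := stepr (g / (2 * (1 + `|Kc|))) (divr_gt0 g0 (mulr_gt0 (ltr0Sn _ 1) K0)).
have : g / (2 * (1 + `|Kc|)) * Kc <= g / 2.
  apply: (@le_trans _ _ (g / (2 * (1 + `|Kc|)) * (1 + `|Kc|))).
    rewrite ler_wpM2l ?divr_ge0 ?mulr_ge0 // ltW //.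
    by apply: le_lt_trans (ler_norm _) _; rewrite ltrDr.
  by rewrite le_eqVlt; apply/orP; left; apply/eqP; field; rewrite gt_eqF.
have : zeta c sigma - b * eps = g + 2 * eps * mu by rewrite /g; ring.
by move=> -> h1 h2; lra.
Qed.

End LowerBound.

(** * Heavy-traffic limits *)

Lemma limf_esup_le (R : realType) (F : set_system R) {FF : Filter F}
    (f : R -> \bar R) (u : R -> R) (l : R) :
  (\forall x \near F, f x <= (u x)%:E)%E -> u x @[x --> F] --> l ->
  (limf_esup f F <= l%:E)%E.
Proof.
move=> fu ul; apply/lee_addgt0Pr => e e0.
have near_e : F [set x | (f x <= (l + e)%:E)%E].
  near=> x; apply: (@le_trans _ _ (u x)%:E); first by near: x.
  rewrite lee_fin; near: x.
  by apply: (cvgr_le _ ul); rewrite ltrDl.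
apply: (@le_trans _ _ (ereal_sup (f @` [set x | (f x <= (l + e)%:E)%E]))).
  by apply: ereal_inf_lbound; exists [set x | (f x <= (l + e)%:E)%E].
by apply: ub_ereal_sup => _ [x fx <-]; rewrite -EFinD.
Unshelve. all: by end_near. Qed.

Lemma limf_einf_ge (R : realType) (F : set_system R) {FF : Filter F}
    (f : R -> \bar R) (u : R -> R) (l : R) :
  (\forall x \near F, (u x)%:E <= f x)%E -> u x @[x --> F] --> l ->
  (l%:E <= limf_einf f F)%E.
Proof.
move=> fu ul; rewrite /limf_einf leeNr -EFinN.
apply: (@limf_esup_le _ _ _ _ (fun x => - u x)); last exact: cvgN.
by apply: filterS fu => x; rewrite EFinN leeN2.
Qed.

Lemma cvg_zeta (R : realType) (L : nat) (c : 'rV[R]_L) (F : set_system R)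
    {FF : Filter F} (sigma : R -> 'I_L -> R) (sigma0 : 'I_L -> R) :
  (forall l, sigma eps l ^+ 2 @[eps --> F] --> sigma0 l ^+ 2) ->
  zeta c (sigma eps) @[eps --> F] --> zeta c sigma0.
Proof.
move=> cvg_sigma; apply: cvg_big => [|l _]; first exact: add_continuous.
by apply: cvgM (cvg_sigma l); exact: cvg_cst.
Qed.

Lemma cvg_sqrt_at_right0 (R : realType) :
  Num.sqrt x @[x --> (0 : R)^'+] --> (0 : R).
Proof.
rewrite -[X in _ --> X]sqrtr0.
by apply: cvg_at_right_filter; exact: sqrt_continuous.
Qed.

Unset Implicit Arguments.

Theorem proposition4 (R : realType) (L Smax Amax K : nat)
    (Ss : {set services L Smax})
    (c : 'I_K -> 'rV[R]_L) (b : 'I_K -> R) (k : 'I_K)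
    (lamk : 'rV[R]_L) (lam : R -> 'rV[R]_L)
    (nu : R -> 'I_L -> probability nat R) (sigma : R -> 'I_L -> R)
    (X : R -> queue_process R L Smax) (Qbar : R -> random_queue R L) :
  let adm := admissible (capacity_region Ss) lam in
  [ffun=> ord0] \in Ss ->
  minimal_face_description (capacity_region Ss) c b ->
  relint (face (capacity_region Ss) (c k) (b k)) lamk ->
  (forall eps, lam eps = lamk - eps *: c k) ->
  (forall eps, adm eps -> arrival_laws Amax nu lam sigma eps) ->
  (forall eps, adm eps -> maxweight Ss (nu eps) (X eps)) ->
  (forall eps, adm eps -> converges_in_distribution (X eps) (Qbar eps)) ->
  (forall eps, adm eps -> finite_moments (Qbar eps)) ->
  (exists B : R -> R,
     (forall eps, adm eps ->
        (mean_inner (c k) (Qbar eps) <=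
         (zeta (c k) (sigma eps) / (2 * eps) + B eps)%:E)%E) /\
     eps * B eps @[eps --> 0^'+] --> (0 : R)) /\
  (forall sigma0 : 'I_L -> R,
     (forall l, sigma eps l ^+ 2 @[eps --> 0^'+] --> sigma0 l ^+ 2) ->
     (limf_esup (fun eps : R => eps%:E * mean_inner (c k) (Qbar eps)) 0^'+ <=
      (zeta (c k) sigma0 / 2)%:E)%E /\
     (forall (Y : R -> queue_process R L Smax) (Qhat : R -> random_queue R L),
        (forall eps, adm eps -> feasible Ss (nu eps) (Y eps)) ->
        (forall eps, adm eps -> converges_in_distribution (Y eps) (Qhat eps)) ->
        ((zeta (c k) sigma0 / 2)%:E <=
         limf_einf (fun eps : R => eps%:E * mean_inner (c k) (Qhat eps)) 0^'+)%E)).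
Proof.
move=> adm s0S Cmin rel lamE laws mw cvgX fm.
have cc : inner (c k) (c k) = 1 by case: Cmin => -[/(_ k)/enorm1].
have c0 l : 0 <= c k 0 l by case: Cmin => -[].
have b0 : 0 <= b k by case: Cmin => -[_ _ /(_ k)/ltW].
have [lamkC lamkb] := facet_lamk rel.
have Ssb s : s \in Ss -> inner (c k) (service_vec R s) <= b k.
  move=> sS; suff /(capacityP Cmin)[_] : capacity_region Ss (service_vec R s) by [].
  exists 1%N, (fun=> service_vec R s), (fun=> 1); split => //.
  - by move=> _; exists s.
  - by rewrite big_ord1.
  - by rewrite big_ord1 scale1r.
have [delta delta0 ball] := facet_ball Cmin rel.
have [C' C'0 upper] := maxweight_mean_upper s0S cc c0 lamkb Ssb delta0 ball (Amax := Amax).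
have adm_near : \forall eps \near 0^'+, adm eps.
  have := interior_shift_facet Cmin rel; apply: filterS2 (nbhs_right_gt 0) => eps.
  by split => //; rewrite lamE.
pose mu eps := fine (mean_inner (c k) (Qbar eps)).
have muE eps : adm eps -> mean_inner (c k) (Qbar eps) = (mu eps)%:E.
  by move=> /fm/(mean_inner_fin_num cc c0)/fineK.
have mu_le eps : adm eps -> eps <= 1 ->
    2 * eps * mu eps <= zeta (c k) (sigma eps) + C' * Num.sqrt eps.
  move=> ea e1; have [e0 _] := ea.
  rewrite -lee_fin EFinM -muE //.
  apply: (upper (nu eps) (X eps)) => //; try by move=> l; have [] := laws eps ea l.
  - by move=> l; have [_ + _] := laws eps ea l; rewrite lamE.
  - exact: mw.
  - exact: cvgX.
  - exact: fm.
have sqrt0 : C' * Num.sqrt eps / 2 @[eps --> 0^'+] --> (0 : R).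
  have : C' * Num.sqrt eps / 2 @[eps --> (0 : R)^'+] --> C' * 0 / 2.
    apply: cvgM (cvg_cst _); apply: cvgM (@cvg_sqrt_at_right0 R); exact: cvg_cst.
  by rewrite mulr0 mul0r.
split.
  (* The positive part of the excess: nonnegativity gives the lower side of the squeeze, and the
     value 0 covers any [eps] that is not admissible. *)
  exists (fun eps => if `[< adm eps >]
    then Num.max 0 (mu eps - zeta (c k) (sigma eps) / (2 * eps)) else 0).
  split => [eps ea|].
    rewrite (asboolT ea) muE // lee_fin -lerBlDl.
    by rewrite le_max lexx orbT.
  apply: (squeeze_cvgr _ (cvg_cst 0) sqrt0).
  near=> eps.
  have e0 : 0 < eps by near: eps; exact: nbhs_right_gt.
  have e1 : eps <= 1 by near: eps; exact: nbhs_right_le.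
  case: asboolP => [ea|_].
    rewrite mulr_ge0 ?le_max ?lexx ?(ltW e0) //=.
    have h := mu_le eps ea e1.
    rewrite maxEle; case: ifPn => _; last first.
      by rewrite mulr0 divr_ge0 // mulr_ge0 ?sqrtr_ge0.
    have -> : eps * (mu eps - zeta (c k) (sigma eps) / (2 * eps)) =
      (2 * eps * mu eps - zeta (c k) (sigma eps)) / 2.
      by field; rewrite gt_eqF.
    by rewrite ler_pM2r // lerBlDl.
  by rewrite mulr0 lexx /= divr_ge0 // mulr_ge0 ?sqrtr_ge0.
move=> sigma0 cvg_sigma.
have cvg_z : zeta (c k) (sigma eps) @[eps --> 0^'+] --> zeta (c k) sigma0.
  exact: cvg_zeta.
split.
  apply: (@limf_esup_le _ _ _ _
    (fun eps => zeta (c k) (sigma eps) / 2 + C' * Num.sqrt eps / 2)).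
    near=> eps.
    have e1 : eps <= 1 by near: eps; exact: nbhs_right_le.
    have ea : adm eps by near: eps.
    have := mu_le eps ea e1; rewrite muE // -EFinM lee_fin; lra.
  rewrite -[X in _ --> X]addr0; apply: cvgD sqrt0.
  exact: cvgM cvg_z (cvg_cst _).
move=> Y Qhat feas cvgY.
apply: (@limf_einf_ge _ _ _ _
  (fun eps => zeta (c k) (sigma eps) / 2 - b k * eps / 2)).
  near=> eps.
  have ea : adm eps by near: eps.
  have [e0 _] := ea.
  have clam : inner (c k) (lam eps) = b k - eps.
    by rewrite lamE innerBr innerZr cc mulr1 lamkb.
  have low : ((zeta (c k) (sigma eps) - b k * eps)%:E <=
      (2 * eps)%:E * mean_inner (c k) (Qhat eps))%E.
    apply: (@lower_mean _ _ _ Amax Ss (c k) (b k) c0 b0 Ssb (nu eps) (Y eps) _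
      (lam eps)) => //; try by move=> l; have [] := laws eps ea l.
    - exact: feas.
    - exact: cvgY.
  rewrite -(@lee_pmul2l _ 2%:E) // muleA -!EFinM.
  by apply: le_trans low; rewrite lee_fin; lra.
have lim : zeta (c k) (sigma eps) / 2 - b k * eps / 2 @[eps --> 0^'+] -->
    zeta (c k) sigma0 / 2 - b k * 0 / 2.
  apply: cvgB; first exact: cvgM cvg_z (cvg_cst _).
  apply: cvgM (cvg_cst _); apply: (cvgM (cvg_cst _)).
  apply: cvg_at_right_filter; exact: cvg_id.
by rewrite mulr0 mul0r subr0 in lim.
Unshelve. all: by end_near. Qed.
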